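(* $$\Bigl(\bigcap_{\overline{\mathfrak{o}}\in\overline{\mathfrak{O}}_{\mathrm{Per}(\sigma)},\ \lambda\in\mathbb{T}}P_{\overline{\mathfrak{o}},\lambda}\Bigr)\cap\Bigl(\bigcap_{\overline{\mathfrak{o}}\in\overline{\mathfrak{O}}_{\mathrm{Aper}(\sigma)}}P_{\overline{\mathfrak{o}}}\Bigr)=\{0\}.$$ In particular, the Banach algebra $\ell^1(\Sigma)$ is semisimple.
   Context: $X$ is a non-empty compact Hausdorff space, $\sigma:X\to X$ is a homeomorphism, $\Sigma=(X,\sigma)$, and $\mathbb{Z}$ acts on $X$ via $n\mapsto\sigma^n$. $\mathrm{Per}(\sigma)$ and $\mathrm{Aper}(\sigma)$ are the sets of points with finite, respectively infinite, orbit. $\overline{\mathfrak{O}}_{\mathrm{Per}(\sigma)}$ (resp. $\overline{\mathfrak{O}}_{\mathrm{Aper}(\sigma)}$) is the set of closures $\overline{\mathfrak{o}}$ of orbits $\mathfrak{o}$ of points in $\mathrm{Per}(\sigma)$ (resp. $\mathrm{Aper}(\sigma)$). $\mathbb{T}$ is the unit circle in $\mathbb{C}$. An intersection over an empty index set is the whole algebra. $C(X)$ carries the supremum norm and $\alpha(f)=f\circ\sigma^{-1}$. $\ell^1(\Sigma)$ is the Banach space of all $a:\mathbb{Z}\to C(X)$ with $\|a\|=\sum_n\|a(n)\|<\infty$, with multiplication $(aa')(n)=\sum_{k\in\mathbb{Z}}a(k)\,\alpha^k(a'(n-k))$ and involution $a^*(n)=\overline{\alpha^n(a(-n))}$. Elements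 are written $a=\sum_nf_n\delta^n$ with $f_n=a(n)$, where $\delta(1)=1$ and $\delta(m)=0$ for $m\ne1$. For $x\in\mathrm{Per}(\sigma)$ of period $p$ and $\lambda\in\mathbb{T}$, $\pi_{x,\lambda}$ is the unital $*$-representation of $\ell^1(\Sigma)$ on the Hilbert space with orthonormal basis $e_0,\dots,e_{p-1}$ given by $\pi_{x,\lambda}(f)e_j=f(\sigma^jx)e_j$ for $f\in C(X)$, $\pi_{x,\lambda}(\delta)e_j=e_{j+1}$ for $0\le j\le p-2$, $\pi_{x,\lambda}(\delta)e_{p-1}=\lambda e_0$. Its kernel depends only on $\lambda$ and the orbit $\mathfrak{o}=\overline{\mathfrak{o}}$ of $x$; it is denoted $P_{\overline{\mathfrak{o}},\lambda}$. For $x\in\mathrm{Aper}(\sigma)$, $\pi_x^1$ is the unital contractive representation on $\ell^1(\mathbb{Z})$ with $\pi_x^1(f)e_k=f(\sigma^kx)e_k$ and $\pi_x^1(\delta)e_k=e_{k+1}$ for $k\in\mathbb{Z}$. Its kernel depends only on the closure $\overline{\mathfrak{o}}$ of the orbit of $x$; it is denoted $P_{\overline{\mathfrak{o}}}$, and equals $\{\sum_nf_n\delta^n: f_n|_{\overline{\mathfrak{o}}}=0\text{ for all }n\}$. All these representations are algebraically irreducible, i.e. non-zero with no invariant subspaces other than $\{0\}$ and the whole space. Semisimple means that the Jacobson radical (the intersection of the kernels of all algebraically irreducible representations on complex vector spaces) is $\{0\}$. *)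

(* Defs.v *)
From HB Require Import structures.
From mathcomp Require Import all_boot all_order all_algebra complex.
From mathcomp Require Import all_classical all_reals all_analysis.
From mathcomp Require summability.
Import Order.TTheory GRing.Theory Num.Theory numFieldNormedType.Exports.
Import ComplexField.Normc.

Set Implicit Arguments.
Unset Strict Implicit.
Unset Printing Implicit Defensive.

Local Open Scope classical_set_scope.
Local Open Scope ring_scope.
Local Open Scope complex_scope.

(* Unordered sum of a family of complex numbers: the limit of the finite
   partial sums.  It is only used on absolutely summable families. *)
Definition zsum (R : realType) (c : int -> R[i]) : R[i] :=
  @summability.sum int R[i] R[i]^o c.

Record homeomorphism (X : topologicalType) := Homeomorphism {
  homeo_fun :> X -> X;
  homeo_inv : X -> X;
  homeo_funK : cancel homeo_fun homeo_inv;
  homeo_invK : cancel homeo_inv homeo_fun;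
  homeo_cts : continuous homeo_fun;
  homeo_inv_cts : continuous homeo_inv }.

(* sigma^n for n : int *)
Definition homeo_iter (X : topologicalType) (s : homeomorphism X) (n : int) :
    X -> X :=
  match n with
  | Posz m => iter m s
  | Negz m => iter m.+1 (homeo_inv s)
  end.

Definition orbit (X : topologicalType) (s : homeomorphism X) (x : X) : set X :=
  range (fun n : int => homeo_iter s n x).

Definition Per (X : topologicalType) (s : homeomorphism X) : set X :=
  [set x | finite_set (orbit s x)].

Definition Aper (X : topologicalType) (s : homeomorphism X) : set X :=
  [set x | infinite_set (orbit s x)].

Definition orbit_closures (X : topologicalType) (s : homeomorphism X)
    (A : set X) : set (set X) :=
  [set closure (orbit s x) | x in A].

Definition has_period (X : topologicalType) (s : homeomorphism X) (x : X)
    (p : nat) : Prop :=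
  [/\ (0 < p)%N, iter p s x = x &
      forall q : nat, (0 < q < p)%N -> iter q s x <> x].

Definition circle (R : realType) : set R[i] := [set lam | `|lam| = 1].

Definition supnorm (R : realType) (X : Type) (f : X -> R[i]) : R :=
  sup (range (fun x => normc (f x))).

(* The underlying set of ell^1(Sigma), inside the vector space of all maps
   int -> X -> R[i]; the element a stands for the sum of the (a n) delta^n. *)
Definition ell1 (R : realType) (X : topologicalType) :
    set (int -> X -> R[i]) :=
  [set a | (forall n : int, continuous (a n : X -> R[i]^o)) /\
           summable [set: int] (fun n : int => (supnorm (a n))%:E)].

(* For a, b in ell1 the series defining the n-th coefficient of a b converges
   absolutely in C(X), so its sum can be computed pointwise. *)
Definition ell1_mul (R : realType) (X : topologicalType)
    (s : homeomorphism X) (a b : int -> X -> R[i]) : int -> X -> R[i] :=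
  fun n x => zsum (fun k : int => a k x * b (n - k) (homeo_iter s (- k) x)).

(* In this group S is a linear subspace of the vector space A, and mul a
   bilinear map which restricts to an associative product on S; only the
   restrictions of mul and pi to S matter. *)
Record representation (K : fieldType) (A : lmodType K) (S : set A)
    (mul : A -> A -> A) (V : lmodType K) (pi : A -> V -> V) : Prop := {
  rep_op_linear : forall a, S a -> linear (pi a);
  rep_linear : forall (c : K) (a b : A), S a -> S b ->
    forall v, pi (c *: a + b) v = c *: pi a v + pi b v;
  rep_mul : forall a b, S a -> S b -> forall v, pi (mul a b) v = pi a (pi b v) }.

Definition invariant_subspace (K : fieldType) (A : lmodType K) (S : set A)
    (V : lmodType K) (pi : A -> V -> V) (W : set V) : Prop :=
  [/\ W 0,
      forall (c : K) (u v : V), W u -> W v -> W (c *: u + v) &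
      forall a v, S a -> W v -> W (pi a v)].

Definition alg_irreducible (K : fieldType) (A : lmodType K) (S : set A)
    (V : lmodType K) (pi : A -> V -> V) : Prop :=
  (exists a v, S a /\ pi a v <> 0) /\
  (forall W : set V, invariant_subspace S pi W -> W = [set 0] \/ W = setT).

Definition rep_kernel (K : fieldType) (A : lmodType K) (S : set A)
    (V : lmodType K) (pi : A -> V -> V) : set A :=
  [set a | S a /\ forall v, pi a v = 0].

Definition jacobson_radical (K : fieldType) (A : lmodType K) (S : set A)
    (mul : A -> A -> A) : set A :=
  [set a | S a /\ forall (V : lmodType K) (pi : A -> V -> V),
     representation S mul pi -> alg_irreducible S pi -> rep_kernel S pi a].

Definition semisimple (K : fieldType) (A : lmodType K) (S : set A)
    (mul : A -> A -> A) : Prop :=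
  jacobson_radical S mul = [set 0].

(* Matrices act on column vectors of length p.+1 = period of x. *)

Definition per_rep_fun (R : realType) (X : topologicalType)
    (s : homeomorphism X) (x : X) (p : nat) (f : X -> R[i]) : 'M[R[i]]_p.+1 :=
  diag_mx (\row_(j < p.+1) f (iter j s x)).

Definition per_rep_delta (R : realType) (p : nat) (lam : R[i]) :
    'M[R[i]]_p.+1 :=
  \matrix_(i < p.+1, j < p.+1)
    (if j == ord_max then lam * (i == ord0)%:R
     else (i == j.+1 :> nat)%:R).

(* The sum over n of pi(f_n) pi(delta)^n, computed entrywise. *)
Definition per_rep (R : realType) (X : topologicalType)
    (s : homeomorphism X) (x : X) (p : nat) (lam : R[i])
    (a : int -> X -> R[i]) : 'M[R[i]]_p.+1 :=
  \matrix_(i < p.+1, j < p.+1)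
    zsum (fun n : int =>
      (per_rep_fun s x p (a n) *m per_rep_delta p lam ^ n) i j).

(* The kernel does not depend on the point x of O. *)
Definition P_per (R : realType) (X : topologicalType) (s : homeomorphism X)
    (O : set X) (lam : R[i]) : set (int -> X -> R[i]) :=
  [set a | exists x p, [/\ Per s x, has_period s x p.+1,
     O = closure (orbit s x) &
     rep_kernel (@ell1 R X) (fun a => mulmx (per_rep s x p lam a)
                                : 'cV[R[i]]_p.+1 -> 'cV[R[i]]_p.+1) a]].

Definition ell1Z (R : realType) : set (int -> R[i]) :=
  [set v | summable [set: int] (fun k : int => (normc (v k))%:E)].

Definition aper_rep_fun (R : realType) (X : topologicalType)
    (s : homeomorphism X) (x : X) (f : X -> R[i]) (v : int -> R[i]) :
    int -> R[i] :=
  fun k => f (homeo_iter s k x) * v k.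

(* The n-th power of the bilateral shift e_k |-> e_{k+1}. *)
Definition aper_rep_delta (R : realType) (n : int) (v : int -> R[i]) :
    int -> R[i] :=
  fun k => v (k - n).

(* The sum over n of pi(f_n) pi(delta)^n, computed coordinatewise. *)
Definition aper_rep (R : realType) (X : topologicalType)
    (s : homeomorphism X) (x : X) (a : int -> X -> R[i]) (v : int -> R[i]) :
    int -> R[i] :=
  fun k => zsum (fun n : int => aper_rep_fun s x (a n) (aper_rep_delta n v) k).

(* The kernel does not depend on the point x with orbit closure O. *)
Definition P_aper (R : realType) (X : topologicalType) (s : homeomorphism X)
    (O : set X) : set (int -> X -> R[i]) :=
  [set a | ell1 a /\ exists x, [/\ Aper s x, O = closure (orbit s x) &
     forall v, ell1Z v -> aper_rep s x a v = 0]].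

(* Main.v *)
Require Import Defs.
From HB Require Import structures.
From mathcomp Require Import all_boot all_order all_algebra complex.
From mathcomp Require Import finmap ring lra zify.
From mathcomp Require Import all_classical all_reals all_analysis.
From mathcomp Require summability cyclic separable cyclotomic.
Import Order.TTheory GRing.Theory Num.Theory numFieldNormedType.Exports.
Import ComplexField.Normc.
Set Implicit Arguments.
Unset Strict Implicit.
Unset Printing Implicit Defensive.
Local Open Scope classical_set_scope.
Local Open Scope ring_scope.
Local Open Scope complex_scope.

(** Every representation involved is given on a space of bounded sequences
    [w : int -> R[i]] by one formula,
    [(pi_x(a) w)(k) = \sum_n a_n(sigma^k x) w(k - n)]: on [ell^1] when [x] is
    aperiodic, and on the quasi-periodic sequences [w(k) = lambda w(k + p)] when
    [x] has period [p], where it is equivalent to [pi_{x,lambda}].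

    If [x] is aperiodic, applying [pi_x(a) = 0] to the basis vectors gives
    [a_n(x) = 0] for all [n].  If [x] has period [p], the sequence
    [k |-> om^(-k)] is quasi-periodic for [lambda = om^p], so
    [\sum_n a_n(x) om^n = 0] for every [om] on the circle, and uniqueness of
    Fourier coefficients gives [a_n(x) = 0] again.

    Semisimplicity follows because these representations are irreducible: by
    Urysohn's lemma a function in [C(X)] isolates (exactly for a finite orbit,
      up
    to a small [ell^1] error otherwise) one coordinate of a non-zero vector, and
    in the second case a Neumann series for convolution removes the error. *)

(** * Unordered sums *)

Section Normc.
Variable R : realType.
Implicit Types (c z : R[i]).

Lemma norm_normc z : `|z| = (normc z)%:C. Proof. by []. Qed.

Lemma normc_ge0 z : 0 <= normc z.
Proof. by rewrite -lecR -norm_normc normr_ge0. Qed.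

Lemma ler_normc_sum (I : Type) (r : seq I) (P : pred I) (F : I -> R[i]) :
  normc (\sum_(i <- r | P i) F i) <= \sum_(i <- r | P i) normc (F i).
Proof.
rewrite -lecR -norm_normc (le_trans (ler_norm_sum _ _ _))//.
by rewrite rmorph_sum.
Qed.

Lemma normc_real (x : R) : normc x%:C = `|x|.
Proof. by rewrite /normc/= expr0n addr0 sqrtr_sqr. Qed.

Lemma normc_distC c z : normc (c - z) = normc (z - c).
Proof. by rewrite -opprB normcN. Qed.

Lemma normc_eq0_eps z : (forall e : R, 0 < e -> normc z <= e) -> z = 0.
Proof.
move=> ze; apply: eq0_normc; apply/eqP; rewrite eq_le normc_ge0 andbT.
by apply/ler_addgt0Pl => e e0; rewrite addr0 ze.
Qed.

Lemma zsum_partial (c : int -> R[i]) (A : {fset int}) :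
  @summability.partial_sum int R[i] c A = \sum_(i <- A) c i.
Proof. by rewrite /summability.partial_sum big_seq_fsetE. Qed.
End Normc.

Section Sums.
Variable R : realType.
Local Notation C := R[i].

(** Convergence along the net of finite subsets. The index type is arbitrary because pairs and
    natural numbers occur as indices too, whereas [zsum] sums over the integers only. *)
Definition has_sum (I : choiceType) (c : I -> C) (s : C) : Prop :=
  forall e : R, 0 < e -> exists F : {fset I}, forall G : {fset I},
    (F `<=` G)%fset -> normc (s - \sum_(i <- G) c i) < e.

(** Absolute summability with an explicit bound on the total, so that estimates can be passed on
    without naming the value of the norm. *)
Definition sum_bounded (I : choiceType) (c : I -> C) (M : R) : Prop :=
  forall F : {fset I}, \sum_(i <- F) normc (c i) <= M.

Lemma has_sum_unique (I : choiceType) (c : I -> C) s t :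
  has_sum c s -> has_sum c t -> s = t.
Proof.
move=> cs ct; apply/eqP; rewrite -subr_eq0; apply/eqP/normc_eq0_eps => e e0.
have e20 : 0 < e / 2 by rewrite divr_gt0.
have [F Fs] := cs _ e20; have [G Gt] := ct _ e20.
have /Fs H1 := fsubsetUl F G; have /Gt H2 := fsubsetUr F G.
set u := \sum_(i <- _) _ in H1 H2.
rewrite -(subrK u s) -addrA (le_trans (le_normcD _ _))// [e]splitr.
by rewrite lerD ?ltW// normc_distC.
Qed.

Lemma has_sum_zsum (c : int -> C) s : has_sum c s -> zsum c = s.
Proof.
move=> cs; have tf := @summability.totally_filter int.
rewrite /zsum /summability.sum; apply: (@cvg_lim C^o (@norm_hausdorff _ C^o)).
apply/(@cvgrPdist_lt _ C^o) => e e0.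
have Ree : e = (complex.Re e)%:C by rewrite RRe_real// gtr0_real.
have [|F HF] := cs (complex.Re e); first by rewrite -ltcR -Ree.
exists F => // G /= FG; rewrite zsum_partial Ree norm_normc ltcR.
exact: HF.
Qed.

Lemma has_sum_ext (I : choiceType) (c d : I -> C) s :
  has_sum c s -> c =1 d -> has_sum d s.
Proof. by move=> cs /funext <-. Qed.

Lemma has_sumD (I : choiceType) (c d : I -> C) s t :
  has_sum c s -> has_sum d t -> has_sum (fun i => c i + d i) (s + t).
Proof.
move=> cs ct e e0; have e20 : 0 < e / 2 by rewrite divr_gt0.
have [F Fs] := cs _ e20; have [G Gt] := ct _ e20.
exists (F `|` G)%fset => H; rewrite fsubUset => /andP[/Fs h1 /Gt h2].
rewrite big_split/= opprD addrACA (le_lt_trans (le_normcD _ _))// [e]splitr.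
by rewrite ltrD.
Qed.

Lemma has_sum0 (I : choiceType) : has_sum (fun _ : I => 0) 0.
Proof. by move=> e e0; exists fset0 => G _; rewrite big1// subrr normc0. Qed.

Lemma has_sumZ (I : choiceType) (c : I -> C) s k :
  has_sum c s -> has_sum (fun i => k * c i) (k * s).
Proof.
move=> cs; have [->|k0] := eqVneq k 0.
  by rewrite mul0r; apply: (has_sum_ext (@has_sum0 I)) => i; rewrite mul0r.
have nk : 0 < normc k.
  by rewrite lt_neqAle normc_ge0 andbT eq_sym;
    apply: contra k0 => /eqP/eq0_normc ->.
move=> e e0; have [|F HF] := cs (e / normc k); first by rewrite divr_gt0.
exists F => G /HF; rewrite -mulr_sumr -mulrBr normcM ltr_pdivlMr//.
by rewrite mulrC.
Qed.

Lemma has_sum_sum (I : choiceType) (J : Type) (r : seq J) (c : J -> I -> C)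
    (s : J -> C) : (forall j, has_sum (c j) (s j)) ->
  has_sum (fun i => \sum_(j <- r) c j i) (\sum_(j <- r) s j).
Proof.
move=> cs; elim: r => [|j r IH].
  by rewrite big_nil; apply: (has_sum_ext (@has_sum0 I)) => i; rewrite big_nil.
rewrite big_cons; apply: (has_sum_ext (has_sumD (cs j) IH)) => i.
by rewrite big_cons.
Qed.

Lemma has_sum_single (I : choiceType) (c : I -> C) i0 :
  (forall i, i != i0 -> c i = 0) -> has_sum c (c i0).
Proof.
move=> c0 e e0; exists [fset i0]%fset => G; rewrite fsub1set => iG.
by rewrite (big_fsetD1 i0)//= big1_seq ?addr0 ?subrr ?normc0// => i /=;
  rewrite !inE => /andP[/c0].
Qed.

(** The condition on [g] says that [c] vanishes off the range of [h]; pushing a finite set forward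
    along [h] therefore misses only zero terms of [F]. *)
Lemma has_sum_reindex (I J : choiceType) (c : I -> C) s (h : J -> I)
    (g : I -> J) : cancel h g -> (forall i, h (g i) != i -> c i = 0) ->
  has_sum c s -> has_sum (c \o h) s.
Proof.
move=> hK c0 cs e e0; have [F HF] := cs _ e0.
exists [fset g i | i in F]%fset => G FG.
have -> : \sum_(j <- G) (c \o h) j = \sum_(i <- [fset h j | j in G]%fset) c i.
  by rewrite big_imfset//= => x y _ _; exact: (can_inj hK).
have /HF := fsubsetUr [fset h j | j in G]%fset F; congr (normc (_ - _) < _).
rewrite [RHS](big_fset_incl _ (fsubsetUl _ F))// => i; rewrite inE => iGF iG.
apply: c0; apply: contra iG => /eqP hgi; apply/imfsetP; exists (g i) => //=.
move: iGF => /orP[/imfsetP[j /= jG ->]|iF]; first by rewrite hK.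
by apply: (fsubsetP FG); rewrite in_imfset.
Qed.

Lemma sum_bounded_ge0 (I : choiceType) (c : I -> C) M : sum_bounded c M -> 0 <=
  M.
Proof. by move=> /(_ fset0); rewrite big_seq_fset0. Qed.

Lemma sum_boundedW (I : choiceType) (c d : I -> C) M :
  (forall i, normc (d i) <= normc (c i)) -> sum_bounded c M -> sum_bounded d M.
Proof. by move=> dc cM F; rewrite (le_trans _ (cM F))// ler_sum. Qed.

Lemma sum_bounded_normc (I : choiceType) (c : I -> C) M :
  sum_bounded c M -> sum_bounded (fun i => (normc (c i))%:C) M.
Proof. by apply: sum_boundedW => i; rewrite normc_real ger0_norm ?normc_ge0.
  Qed.

Lemma sum_boundedZ (I : choiceType) (c d : I -> C) (k M : R) : 0 <= k ->
  (forall i, normc (d i) <= k * normc (c i)) -> sum_bounded c M ->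
  sum_bounded d (k * M).
Proof.
move=> k0 dc cM F; apply: (@le_trans _ _ (\sum_(i <- F) k * normc (c i))).
  exact: ler_sum.
by rewrite -mulr_sumr ler_wpM2l.
Qed.

Lemma sum_boundedD (I : choiceType) (c d : I -> C) M N :
  sum_bounded c M -> sum_bounded d N ->
  sum_bounded (fun i => c i + d i) (M + N).
Proof.
move=> cM dN F; apply: (le_trans _ (lerD (cM F) (dN F))).
by rewrite -big_split ler_sum//= => i _; exact: le_normcD.
Qed.

Lemma big_fsubset (V : nmodType) (I : choiceType) (F : I -> V) (A B : {fset I})
  : (A `<=` B)%fset ->
  \sum_(i <- B) F i = \sum_(i <- A) F i + \sum_(i <- (B `\` A)%fset) F i.
Proof.
move=> /fsubsetP AB; rewrite (big_fsetID _ (mem A))/=; congr (_ + _).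
  apply: eq_fbigl => i; rewrite !inE/=; apply/andP/idP => [[]//|iA].
  by rewrite iA AB.
by apply: eq_fbigl => i; rewrite !inE/= andbC.
Qed.

Lemma ler_sum_fsubset (I : choiceType) (f : I -> R) (A B : {fset I}) :
  (forall i, 0 <= f i) -> (A `<=` B)%fset ->
  \sum_(i <- A) f i <= \sum_(i <- B) f i.
Proof. by move=> f0 /big_fsubset ->; rewrite lerDl sumr_ge0. Qed.

Lemma sum_bounded_finsupp (I : choiceType) (c : I -> C) (F : {fset I}) :
  (forall i, i \notin F -> c i = 0) ->
  sum_bounded c (\sum_(i <- F) normc (c i)).
Proof.
move=> c0 G; rewrite [leRHS](big_fset_incl _ (fsubsetUr G F)).
  by apply: ler_sum_fsubset; [move=> i; exact: normc_ge0|exact: fsubsetUl].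
by move=> i _ /c0 ->; rewrite normc0.
Qed.

Lemma sum_bounded_le (I : choiceType) (c : I -> C) M i :
  sum_bounded c M -> normc (c i) <= M.
Proof. by move=> /(_ [fset i]%fset); rewrite big_seq_fset1. Qed.

Lemma sum_bounded_reindex (I J : choiceType) (c : I -> C) M (h : J -> I) :
  injective h -> sum_bounded c M -> sum_bounded (c \o h) M.
Proof.
move=> hI cM F; apply: le_trans (cM [fset h j | j in F]%fset).
by rewrite big_imfset//= => x y _ _; exact: hI.
Qed.

Lemma has_sum_normc_le (I : choiceType) (c : I -> C) s M :
  sum_bounded c M -> has_sum c s -> normc s <= M.
Proof.
move=> cM cs; apply/ler_addgt0Pl => e e0; have [F /(_ F) /= h] := cs _ e0.
rewrite -(subrK (\sum_(i <- F) c i) s) (le_trans (le_normcD _ _))//.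
apply: lerD; first exact: ltW (h (fsubset_refl F)).
exact: le_trans (ler_normc_sum _ _ _) (cM F).
Qed.

Lemma ler_normc_has_sum (I : choiceType) (c : I -> C) s (t : R) :
  has_sum c s -> has_sum (fun i => (normc (c i))%:C) t%:C -> normc s <= t.
Proof.
move=> cs ct; apply/ler_addgt0Pl => e e0.
have e20 : 0 < e / 2 by rewrite divr_gt0.
have [F HF] := cs _ e20; have [G HG] := ct _ e20.
have /HF := fsubsetUl F G; have /HG := fsubsetUr F G.
set H := (F `|` G)%fset; rewrite -rmorph_sum.
set u := \sum_(_ <- _) _; set v := \sum_(_ <- _) _.
rewrite -rmorphB normc_real ltr_norml => h1 h2.
have vu : normc v <= u by exact: ler_normc_sum.
by have := le_normcD (s - v) v; rewrite subrK; lra.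
Qed.

(** The sum is the supremum of the finite partial sums, which increase with the index set. *)
Lemma has_sum_nneg (I : choiceType) (f : I -> R) M : (forall i, 0 <= f i) ->
  (forall F : {fset I}, \sum_(i <- F) f i <= M) ->
  exists2 s : R, 0 <= s & has_sum (fun i => (f i)%:C) s%:C.
Proof.
move=> f0 fM.
pose A : set R := range (fun F : {fset I} => \sum_(i <- F) f i).
have Asup : has_sup A.
  split; first by exists (\sum_(i <- fset0) f i); exists fset0.
  by exists M => _ [F _ <-].
exists (sup A) => [|e e0].
  apply: ub_le_sup; first by case: Asup.
  by exists fset0; rewrite ?big_seq_fset0.
have [_ [F _ <-] HF] := sup_adherent e0 Asup.
exists F => G FG; rewrite -rmorph_sum -rmorphB normc_real ltr_norml.
have leG : \sum_(i <- G) f i <= sup A by apply: ub_le_sup;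
  [case: Asup|exists G].
have := ler_sum_fsubset f0 FG => leFG.
by apply/andP; split; lra.
Qed.

Lemma sum_bounded_has_sum (I : choiceType) (c : I -> C) M :
  sum_bounded c M -> exists s, has_sum c s.
Proof.
move=> cM.
have part (f : I -> R) : (forall i, 0 <= f i <= normc (c i)) ->
    exists s, has_sum (fun i => (f i)%:C) s.
  move=> fc; have [||s _ fs] := @has_sum_nneg _ f M; last by exists s%:C.
    by move=> i; case/andP: (fc i).
  by move=> F; rewrite (le_trans _ (cM F))// ler_sum// => i _;
    case/andP: (fc i).
have reim (z : C) : `|complex.Re z| <= normc z /\ `|complex.Im z| <= normc z.
  case: z => a b /=; rewrite -!sqrtr_sqr.
  by split; rewrite ler_wsqrtr// ?lerDl ?lerDr sqr_ge0.
(* The positive and negative parts of the real and imaginary parts are four non-negative families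
   dominated by [normc (c i)]; [c] is recombined from their sums. *)
have [|s1 h1] := part (fun i => (`|complex.Re (c i)| + complex.Re (c i)) / 2).
  by move=> i; have [+ _] := reim (c i); case: (ger0P (complex.Re (c i))); lra.
have [|s2 h2] := part (fun i => (`|complex.Re (c i)| - complex.Re (c i)) / 2).
  by move=> i; have [+ _] := reim (c i); case: (ger0P (complex.Re (c i))); lra.
have [|s3 h3] := part (fun i => (`|complex.Im (c i)| + complex.Im (c i)) / 2).
  by move=> i; have [_ +] := reim (c i); case: (ger0P (complex.Im (c i))); lra.
have [|s4 h4] := part (fun i => (`|complex.Im (c i)| - complex.Im (c i)) / 2).
  by move=> i; have [_ +] := reim (c i); case: (ger0P (complex.Im (c i))); lra.
eexists; apply: has_sum_ext.
  exact: has_sumD (has_sumD h1 (has_sumZ (-1) h2))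
    (has_sumZ 'i (has_sumD h3 (has_sumZ (-1) h4))).
by move=> i /=; case: (c i) => a b /=; simpc; congr (_ +i* _); field.
Qed.

Lemma sum_bounded_zsum (c : int -> C) M :
  sum_bounded c M -> has_sum c (zsum c).
Proof.
by move=> /sum_bounded_has_sum[s cs]; rewrite (has_sum_zsum cs).
Qed.

(** Cauchy criterion for the norms: the sum over [G] is the difference of the partial sums over [F]
    and over the union of [F] and [G], each within [e / 2] of the limit. *)
Lemma sum_bounded_tail (I : choiceType) (c : I -> C) M (e : R) : 0 < e ->
  sum_bounded c M -> exists F : {fset I}, forall G : {fset I},
    [disjoint F & G]%fset -> \sum_(i <- G) normc (c i) <= e.
Proof.
move=> e0 /sum_bounded_normc/sum_bounded_has_sum[s cs].
have e20 : 0 < e / 2 by rewrite divr_gt0.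
have [F HF] := cs _ e20; exists F => G FG.
have := HF _ (fsubset_refl F); have := HF _ (fsubsetUl F G).
rewrite (big_fsubset _ (fsubsetUl F G)).
have -> : ((F `|` G) `\` F = G)%fset.
  by rewrite fsetDUl fsetDv fset0U; apply/fsetDidPl; rewrite fdisjoint_sym.
set u := \sum_(i <- F) _; rewrite -rmorph_sum;
  set t := \sum_(i <- G) _ => h1 h2.
apply: (le_trans (ler_norm t)); rewrite -normc_real.
rewrite (_ : t%:C = (s - u) - (s - (u + t%:C))); last by ring.
by rewrite (le_trans (le_normcD _ _))// normcN [leRHS]splitr lerD ?ltW.
Qed.

Lemma big_fsetX (V : nmodType) (I J : choiceType) (c : I * J -> V) (A : {fset
  I}) (B : {fset J}) :
  \sum_(k <- (A `*` B)%fset) c k = \sum_(i <- A) \sum_(j <- B) c (i, j).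
Proof.
rewrite -big_allpairs/=.
apply: perm_big; apply: uniq_perm => [||[i j]].
- exact: fset_uniq.
- by apply: allpairs_uniq => [||[? ?] [? ?] _ _ /= [-> ->]//]; exact: fset_uniq.
- rewrite in_fsetM/=; apply/andP/allpairsP => [[iA jB]|[[u v] [uA vB [->
  ->]]]//].
  by exists (i, j).
Qed.

Lemma sum_bounded_dom (I : choiceType) (c : I -> C) (al : I -> R) M :
  (forall i, normc (c i) <= al i) ->
  (forall F : {fset I}, \sum_(i <- F) al i <= M) -> sum_bounded c M.
Proof. by move=> ca aM F; rewrite (le_trans _ (aM F))// ler_sum. Qed.

Lemma sum_le_mulr (I : choiceType) (al : I -> R) M B : 0 <= B ->
  (forall F : {fset I}, \sum_(i <- F) al i <= M) ->
  forall F : {fset I}, \sum_(i <- F) al i * B <= M * B.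
Proof. by move=> B0 aM F; rewrite -mulr_suml ler_wpM2r. Qed.

(** * Double families and exchange of summation *)

Section Double.
Variables (I J : choiceType).
Implicit Types (c : I -> J -> C) (f : I -> R).

(** A finite set of pairs lies in the rectangle spanned by its projections, and a rectangle is
    estimated row by row. *)
Lemma sum_bounded_double c f M :
  (forall i, sum_bounded (c i) (f i)) ->
  (forall F : {fset I}, \sum_(i <- F) f i <= M) ->
  sum_bounded (fun k : I * J => c k.1 k.2) M.
Proof.
move=> cf fM G; set A := [fset k.1 | k in G]%fset;
  set B := [fset k.2 | k in G]%fset.
apply: (@le_trans _ _ (\sum_(k <- (A `*` B)%fset) normc (c k.1 k.2))).
  apply: ler_sum_fsubset => [k|]; first exact: normc_ge0.
  by apply/fsubsetP => k kG; rewrite in_fsetM; apply/andP; split;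
    apply/imfsetP; exists k.
by rewrite big_fsetX/= (le_trans _ (fM A))// ler_sum// => i _; exact: cf.
Qed.

Lemma has_sum_double c r s :
  has_sum (fun k : I * J => c k.1 k.2) s -> (forall i, has_sum (c i) (r i)) ->
  has_sum r s.
Proof.
move=> cs cr e e0; have e20 : 0 < e / 2 by rewrite divr_gt0.
have [F HF] := cs _ e20; exists [fset k.1 | k in F]%fset => A FA.
(* One finite set of columns approximates the finitely many rows in [A] simultaneously; enlarging it
   to [B'] makes the rectangle contain [F]. *)
have [B HB] := has_sum_sum (enum_fset A) cr e20.
pose B' := (B `|` [fset k.2 | k in F])%fset.
have /HB h1 : (B `<=` B')%fset by exact: fsubsetUl.
have /HF h2 : (F `<=` A `*` B')%fset.
  apply/fsubsetP => k kF; rewrite in_fsetM (fsubsetP FA) ?in_imfset//=.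
  by rewrite inE; apply/orP; right; apply/imfsetP; exists k.
move: h1 h2; rewrite big_fsetX/= exchange_big/=.
set u := \sum_(_ <- _) _; set t := \sum_(_ <- _) _ => h1 h2.
rewrite -(subrK t s) -addrA (le_lt_trans (le_normcD _ _))// [e]splitr.
by rewrite ltrD// normc_distC.
Qed.

Lemma sum_bounded_rows c M r :
  sum_bounded (fun k : I * J => c k.1 k.2) M ->
  (forall i, has_sum (c i) (r i)) -> sum_bounded r M.
Proof.
move=> cM cr A.
have tex i : exists t : R, 0 <= t /\ has_sum (fun j => (normc (c i j))%:C) t%:C.
  have [|F|t t0 ct] := @has_sum_nneg _ (fun j => normc (c i j)) M.
  - by move=> j; exact: normc_ge0.
  - by apply: (sum_bounded_reindex (h := pair i) _ cM) => ? ? [].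
  - by exists t.
(* [t i] is the sum of the norms in row [i]; a finite sum of these is a limit of sums over finite
   rectangles, each at most [M]. *)
have [t ct] := choice tex.
have rt i : normc (r i) <= t i.
  by have [_] := ct i; exact: ler_normc_has_sum.
have /has_sum_normc_le tM : has_sum (fun j => \sum_(i <- A) (normc (c i j))%:C)
    (\sum_(i <- A) (t i)%:C).
  by apply: has_sum_sum => i; case: (ct i).
apply: (@le_trans _ _ (\sum_(i <- A) t i)); first exact: ler_sum.
apply: le_trans (ler_norm _) _; rewrite -normc_real rmorph_sum.
apply: tM => B; apply: le_trans (cM (A `*` B)%fset).
rewrite big_fsetX/= exchange_big/=; apply: ler_sum => j _.
by rewrite -rmorph_sum normc_real ger0_norm// sumr_ge0// => i _;
  exact: normc_ge0.
Qed.

End Double.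

Section Exchange.
Variables (I J : choiceType).
Implicit Types (c : I -> J -> C) (f : I -> R).

Lemma sum_bounded_swap c M : sum_bounded (fun k : I * J => c k.1 k.2) M ->
  sum_bounded (fun k : J * I => c k.2 k.1) M.
Proof.
by apply: (sum_bounded_reindex (h := fun k : J * I => (k.2, k.1))) => -[? ?] [?
  ?] [-> ->].
Qed.

Lemma sum_bounded_col c f M j :
  (forall i, sum_bounded (c i) (f i)) ->
  (forall F : {fset I}, \sum_(i <- F) f i <= M) -> sum_bounded (c^~ j) M.
Proof.
move=> cf fM; have cM := sum_bounded_double cf fM.
by apply: (sum_bounded_reindex (h := fun i => (i, j)) _ cM) => ? ? [].
Qed.

(** Fubini: the domination makes the family of pairs absolutely summable, and both iterated sums
    agree with its sum. *)
Lemma has_sum_exchange c f M r t :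
  (forall i, sum_bounded (c i) (f i)) ->
  (forall F : {fset I}, \sum_(i <- F) f i <= M) ->
  (forall i, has_sum (c i) (r i)) -> (forall j, has_sum (c^~ j) (t j)) ->
  (exists s, has_sum r s /\ has_sum t s) /\ sum_bounded t M.
Proof.
move=> cf fM cr ct; have cM := sum_bounded_double cf fM.
split; last exact: (@sum_bounded_rows _ _ (fun j i => c i j)) (sum_bounded_swap
  cM) ct.
have [s cs] := sum_bounded_has_sum cM; exists s; split.
  exact: has_sum_double cs cr.
apply: (@has_sum_double _ _ (fun j i => c i j)) ct.
by apply: (has_sum_reindex (h := fun k : J * I => (k.2, k.1))
  (g := fun k : I * J => (k.2, k.1))) cs => [[]//|[? ?]]; rewrite eqxx.
Qed.
End Exchange.
End Sums.

(** * Fourier uniqueness *)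

Section Fourier.
Variable R : realType.
Local Notation C := R[i].

(** As [n] is non-zero in [F], the polynomial ['X^n - 1] is separable; having [n] distinct roots of
    unity forces a primitive one among them. *)
Lemma primitive_root_exists (F : closedFieldType) n :
  n%:R != 0 :> F -> exists z : F, n.-primitive_root z.
Proof.
move=> n0; have n_gt0 : (0 < n)%N by case: n n0 => //; rewrite eqxx.
have [r Dp] := closed_field_poly_normal ('X^n - 1 : {poly F}).
move: Dp; rewrite (monicP _) ?monicXnsubC// scale1r => Dp.
have rn1 : all n.-unity_root r.
  by apply/allP => z; rewrite -root_prod_XsubC -Dp.
have sz_r : (n < (size r).+1)%N.
  by rewrite -(size_prod_XsubC r id) -Dp size_XnsubC.
have [|z _ ?] := hasP (cyclic.has_prim_root n_gt0 rn1 _ sz_r); last by exists z.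
by rewrite -separable.separable_prod_XsubC -Dp cyclotomic.separable_Xn_sub_1.
Qed.

(** A geometric sum with ratio [z ^ m], which differs from 1 because [N] does not divide [m], while
    its [N]-th power is 1. *)
Lemma unity_root_sum (F : fieldType) N (z : F) (m : int) :
  N.-primitive_root z -> (0 < `|m| < N)%N -> \sum_(j < N) (z ^+ j) ^ m = 0.
Proof.
move=> zN /andP[m0 mN]; have zN1 := prim_expr_order zN.
have y1 : z ^ m != 1.
  case: m m0 mN => q q0 qN; rewrite ?NegzE -?exprnN ?invr_eq1 -?exprnP
    -(prim_order_dvd zN) gtnNdvd//.
have : (z ^ m - 1) * \sum_(j < N) (z ^ m) ^+ j = 0.
  by rewrite -subrX1 exprnP exprzAC -exprnP zN1 exp1rz subrr.
move=> /eqP; rewrite mulf_eq0 subr_eq0 (negbTE y1)/= => /eqP h; rewrite -[RHS]h.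
by apply: eq_bigr => j _; rewrite !exprnP exprzAC.
Qed.

Lemma normc_circle (w : C) : `|w| = 1 -> normc w = 1.
Proof. by move=> h; apply: (@complexI R); rewrite -norm_normc. Qed.

Lemma norm_exprz1 (w : C) (m : int) : `|w| = 1 -> `|w ^ m| = 1.
Proof.
by move=> w1; case: m => q; rewrite ?NegzE -?exprnN ?normfV normrX w1 expr1n
  ?invr1.
Qed.

(** Averaging over the [N]-th roots of unity replaces integration over the circle: the weight [kap]
    is 1 at [k], vanishes at the other points of a large finite set [F], and has norm at most 1 on
    the tail. *)
Lemma fourier_unique (f : int -> C) M : sum_bounded f M ->
  (forall w : C, `|w| = 1 -> has_sum (fun n => f n * w ^ n) 0) ->
  forall k, f k = 0.
Proof.
move=> fM f0 k; apply: normc_eq0_eps => e e0.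
have [F HF] := sum_bounded_tail e0 fM.
(* [N] exceeds every [|n - k|] with [n] in [F], so [N] divides no non-zero difference [n - k]. *)
pose N := (\sum_(n <- F) `|n - k|%N).+1.
have N0 : N%:R != 0 :> C by rewrite pnatr_eq0.
have [z zN] := primitive_root_exists N0.
have nz (j : nat) : `|z ^+ j| = 1.
  apply/eqP; rewrite -(@pexpr_eq1 _ _ N)// -normrX -exprM mulnC exprM.
  by rewrite (prim_expr_order zN) expr1n normr1.
have zj0 (j : nat) : z ^+ j != 0 by rewrite -normr_eq0 nz oner_eq0.
pose kap (n : int) := N%:R^-1 * \sum_(j < N) (z ^+ j) ^ (n - k).
have kapk : kap k = 1.
  rewrite /kap subrr (eq_bigr (fun=> 1)); last by move=> j _; rewrite expr0z.
  by rewrite sumr_const card_ord mulVf.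
have kap1 n : normc (kap n) <= 1.
  rewrite -lecR -norm_normc normrM normfV ler_pdivrMl ?normr_gt0//.
  rewrite mulr1 (le_trans (ler_norm_sum _ _ _))//.
  rewrite (eq_bigr (fun=> 1)) ?sumr_const ?card_ord ?normr_nat// => j _.
  exact: norm_exprz1.
have kapF n : n \in F -> n != k -> kap n = 0.
  move=> nF nk; rewrite /kap unity_root_sum ?mulr0//.
  rewrite absz_gt0 subr_eq0 nk ltnS (big_fsetD1 n)//=; exact: leq_addr.
have hs : has_sum (fun n => kap n * f n) 0.
  have h (j : 'I_N) : has_sum (fun n => f n * (z ^+ j) ^ (n - k)) 0.
    have := has_sumZ ((z ^+ j) ^ (- k)) (f0 _ (nz j)); rewrite mulr0.
    move/has_sum_ext; apply => n.
    by rewrite expfzDr// mulrCA [X in f n * X]mulrC.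
  have := has_sumZ N%:R^-1 (has_sum_sum (index_enum 'I_N) h).
  rewrite big1// mulr0; move/has_sum_ext; apply => n.
  by rewrite /kap -mulr_sumr mulrCA mulrC.
(* Adding [- f k] at the index [k] cancels the term there: the sum becomes [- f k], and its terms
   vanish at [k] and on [F], leaving only the tail. *)
have /(has_sumD hs) : has_sum (fun n => if n == k then - f k else 0) (- f k).
  have := @has_sum_single _ _ (fun n : int => if n == k then - f k else 0) k.
  by rewrite eqxx; apply => i /negbTE ->.
rewrite add0r => /has_sum_normc_le; rewrite normcN; apply => G.
pose d (n : int) : C := kap n * f n + (if n == k then - f k else 0).
rewrite (eq_bigr (fun n => normc (d n)))//.
have dk n : n = k -> d n = 0 by move=> ->; rewrite /d eqxx kapk mul1r subrr.
rewrite -(@big_fset_incl _ _ _ _ (G `\` F)%fset)/=; first last.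
- move=> n nG; rewrite inE nG andbT negbK => nF; have [/dk->|nk] := eqVneq n k.
    by rewrite normc0.
  by rewrite /d kapF// mul0r add0r (negbTE nk) normc0.
- exact: fsubsetDl.
apply: le_trans (HF (G `\` F)%fset _); last first.
  by apply/fdisjointP => n nF; rewrite inE nF.
apply: ler_sum => n _; have [/dk->|nk] := eqVneq n k.
  by rewrite normc0 normc_ge0.
by rewrite /d (negbTE nk) addr0 normcM ler_piMl// normc_ge0.
Qed.
End Fourier.

(** * The operators of the orbit representations *)

Section HomeoIter.
Variables (X : topologicalType) (s : homeomorphism X).

Lemma homeo_iterS n x : homeo_iter s (n + 1) x = s (homeo_iter s n x).
Proof.
case: n => [m|[|m]]; first by rewrite -PoszD addn1.
  by rewrite /= homeo_invK.
by rewrite (_ : Negz m.+1 + 1 = Negz m); [rewrite /= homeo_invK|lia].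
Qed.

Lemma homeo_iterB1 n x : homeo_iter s (n - 1) x = homeo_inv s (homeo_iter s n
  x).
Proof. by rewrite -[n in RHS](subrK 1) homeo_iterS homeo_funK. Qed.

Lemma homeo_iterD m n x :
  homeo_iter s (m + n) x = homeo_iter s m (homeo_iter s n x).
Proof.
elim/int_ind: m => [|m IH|m IH]; first by rewrite add0r.
  by rewrite -addn1 PoszD addrAC !homeo_iterS IH.
by rewrite -addn1 PoszD opprD addrAC !homeo_iterB1 IH.
Qed.

Lemma homeo_iter_continuous n : continuous (homeo_iter s n).
Proof.
suff it (f : X -> X) m : continuous f -> continuous (iter m f).
  by case: n => m; apply: it; [exact: homeo_cts|exact: homeo_inv_cts].
move=> cf; elim: m => [|m IH] y /=; first exact: cvg_id.
exact: continuous_comp (IH y) (cf _).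
Qed.
End HomeoIter.

Section Summable.
Variable R : realType.

Lemma summableP (f : int -> R) : (forall n, 0 <= f n) ->
  (summable [set: int] (EFin \o f) <->
   exists M, forall F : {fset int}, \sum_(n <- F) f n <= M).
Proof.
move=> f0.
have E (F : {fset int}) :
    (\sum_(n \in [set` F]) `|(f n)%:E|)%E = (\sum_(n <- F) f n)%:E.
  rewrite fsbig_finite//= set_fsetK -sumEFin; apply: eq_bigr => n _.
  by rewrite ger0_norm.
rewrite /summable /esum; split=> [|[M fM]].
  move=> h; exists (fine (ereal_sup [set (\sum_(n \in A) `|(f n)%:E|)%E | A in
    fsets [set: int]])).
  move=> F.
  have le : ((\sum_(n <- F) f n)%:E <= ereal_sup [set (\sum_(n \in A) `|(f
    n)%:E|)%E | A in fsets [set: int]])%E.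
    by apply: ereal_sup_ubound; exists [set` F]; rewrite ?E//; split.
  by case: ereal_sup h le => //= r _.
apply: (@le_lt_trans _ _ M%:E); last exact: ltry.
apply: ge_ereal_sup => _ [A [fA _] <-].
by rewrite -(fset_setK fA) E lee_fin.
Qed.

Lemma ell1ZP (w : int -> R[i]) : ell1Z w <-> exists M, sum_bounded w M.
Proof. by apply: summableP => n; exact: normc_ge0. Qed.
End Summable.

Section Ell1.
Variables (R : realType) (X : topologicalType).
Local Notation C := R[i].
Hypotheses (X0 : [set: X] !=set0) (cX : compact [set: X]).

Lemma normc_continuous (f : X -> C^o) :
  continuous f -> continuous (fun y => normc (f y)).
Proof.
move=> cf y; apply/cvgrPdist_lt => e e0.
have := (@cvgrPdist_lt _ C^o _ _ (nbhs_filter y) _ _).1 (cf y) (e%:C : C);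
  rewrite ltcR => /(_ e0).
apply: filterS => z; rewrite norm_normc ltcR; apply: le_lt_trans.
rewrite ler_norml; apply/andP; split.
  have := le_normcD (f z - f y) (f y); rewrite subrK normc_distC; lra.
have := le_normcD (f y - f z) (f z); rewrite subrK; lra.
Qed.

(** Compactness bounds the range, so that [sup] is a genuine upper bound. *)
Lemma normc_le_supnorm (f : X -> C^o) y :
  continuous f -> normc (f y) <= supnorm f.
Proof.
move=> cf; apply: ub_le_sup; last by exists y.
have cn := normc_continuous cf.
have [c _ fc] := compact_EVT_max X0 cX (continuous_subspaceT cn).
by exists (normc (f c)) => _ [z _ <-]; apply: fc; rewrite inE.
Qed.

(** Any summable pointwise majorant [al] witnesses membership, which spares the computation of
    supremum norms. *)
Lemma ell1P (a : int -> X -> C) : ell1 a <->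
  (forall n, continuous (a n : X -> C^o)) /\
  exists (al : int -> R) M, (forall n y, normc (a n y) <= al n) /\
    (forall F : {fset int}, \sum_(n <- F) al n <= M).
Proof.
have [x0 _] := X0.
split=> [[ca /summableP sa]|[ca [al [M [aal alM]]]]]; split=> //.
  have [|M aM] := sa _.
    move=> n; apply: le_trans (normc_ge0 _) (normc_le_supnorm x0 (ca n)).
  by exists (fun n => supnorm (a n)), M; split=> // n y;
    exact: normc_le_supnorm.
apply/summableP => [n|].
  by apply: le_trans (normc_ge0 _) (normc_le_supnorm x0 (ca n)).
exists M => F; apply: le_trans (alM F); apply: ler_sum => n _.
apply: ge_sup; first by exists (normc (a n x0)), x0.
by move=> _ [y _ <-].
Qed.
End Ell1.

(** A common domain for the operators: it contains both [ell1Z] and, for [lambda] on the circle, the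
    quasi-periodic sequences. *)
Definition bounded_seq (R : realType) : set (int -> R[i]) :=
  [set w | exists B, forall k, normc (w k) <= B].

Section Op.
Variables (R : realType) (X : topologicalType) (s : homeomorphism X).
Local Notation C := R[i].
Hypotheses (X0 : [set: X] !=set0) (cX : compact [set: X]).
Variable x : X.
Local Notation op := (aper_rep s x).

Lemma ell1Z_bounded (w : int -> C) : ell1Z w -> bounded_seq w.
Proof. by move=> /ell1ZP[M wM]; exists M => k; exact: sum_bounded_le wM. Qed.

Lemma aper_rep_terms (a : int -> X -> C) w : ell1 a -> bounded_seq w ->
  exists M, forall y k, sum_bounded (fun n => a n y * w (k - n)) M.
Proof.
move=> /(ell1P X0 cX)[_ [al [M [aal alM]]]] [B wB].
have B0 : 0 <= B by apply: le_trans (normc_ge0 _) (wB 0).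
exists (M * B) => y k; apply: sum_bounded_dom (sum_le_mulr B0 alM) => n.
by rewrite normcM ler_pM ?normc_ge0.
Qed.

Lemma aper_rep_has_sum (a : int -> X -> C) w k : ell1 a -> bounded_seq w ->
  has_sum (fun n => a n (homeo_iter s k x) * w (k - n)) (op a w k).
Proof. by move=> /aper_rep_terms h /h[M /(_ _ k)/sum_bounded_zsum]; exact. Qed.

Lemma aper_rep_bounded (a : int -> X -> C) w : ell1 a -> bounded_seq w ->
  bounded_seq (op a w).
Proof.
move=> ea bw; have [M aM] := aper_rep_terms ea bw; exists M => k.
exact: has_sum_normc_le (aM _ _) (aper_rep_has_sum k ea bw).
Qed.

Lemma aper_rep_linear (a : int -> X -> C) (c : C) (v w : int -> C) :
  ell1 a -> bounded_seq v -> bounded_seq w ->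
  op a (c *: v + w) = c *: op a v + op a w.
Proof.
move=> ea bv bw; apply/funext => k; apply: has_sum_zsum.
have := has_sumD (has_sumZ c (aper_rep_has_sum k ea bv)) (aper_rep_has_sum k ea
  bw).
by move/has_sum_ext; apply => n; rewrite mulrCA -mulrDr.
Qed.

Lemma aper_repD (c : C) (a b : int -> X -> C) w :
  ell1 a -> ell1 b -> bounded_seq w ->
  op (c *: a + b) w = c *: op a w + op b w.
Proof.
move=> ea eb bw; apply/funext => k; apply: has_sum_zsum.
have := has_sumD (has_sumZ c (aper_rep_has_sum k ea bw)) (aper_rep_has_sum k eb
  bw).
by move/has_sum_ext; apply => n; rewrite mulrA -mulrDl.
Qed.

Lemma aper_rep_mul (a b : int -> X -> C) w : ell1 a -> ell1 b ->
  bounded_seq w -> op (ell1_mul s a b) w = op a (op b w).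
Proof.
move=> ea eb bw; have bbw := aper_rep_bounded eb bw.
have /(ell1P X0 cX)[_ [al [MA [aal alM]]]] := ea.
have /(ell1P X0 cX)[_ [be [MB [bbe beM]]]] := eb.
apply/funext => k; set y := homeo_iter s k x.
have yE n : homeo_iter s (k - n) x = homeo_iter s (- n) y.
  by rewrite -homeo_iterD addrC.
(* With [l = n + m], row [n] sums to the [n]-th term of [op a (op b w) k], and column [l] to the
   [l]-th term of the product acting on [w]. *)
pose c n l := a n y * (b (l - n) (homeo_iter s (k - n) x) * w (k - l)).
have [B bB] := aper_rep_terms eb bw.
have al0 n : 0 <= al n by apply: le_trans (normc_ge0 _) (aal n x).
have B0 : 0 <= B by apply: sum_bounded_ge0 (bB x 0).
have MB0 : 0 <= MB by have := beM fset0; rewrite big_seq_fset0.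
have cn n : sum_bounded (c n) (al n * B).
  apply: sum_boundedZ (sum_bounded_reindex (h := fun l => l - n) _ (bB
    (homeo_iter s (k - n) x) (k - n))) => //; last exact: addIr.
  move=> l /=; rewrite opprB addrA subrK [X in X <= _]normcM.
  by rewrite ler_wpM2r ?normc_ge0.
have cr n : has_sum (c n) (a n y * op b w (k - n)).
  apply: has_sumZ; have := aper_rep_has_sum (k - n) eb bw.
  move/(has_sum_reindex (h := fun l => l - n) (g := fun m => m + n)).
  move=> h; apply: has_sum_ext (h _ _) _ => [l|m|l] /=.
  - exact: subrK.
  - by rewrite addrK eqxx.
  - by rewrite opprB addrA subrK.
have ct l : has_sum (c^~ l) (ell1_mul s a b l y * w (k - l)).
  have : sum_bounded (fun n => a n y * b (l - n) (homeo_iter s (- n) y)) (MA *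
    MB).
    apply: sum_bounded_dom (sum_le_mulr MB0 alM) => n.
    rewrite normcM ler_pM ?normc_ge0// (le_trans (bbe _ _))//.
    by have := beM [fset l - n]%fset; rewrite big_seq_fset1.
  move=> /sum_bounded_zsum/(has_sumZ (w (k - l))); rewrite mulrC.
  by move/has_sum_ext; apply => n; rewrite /c yE mulrC mulrA.
have [[t [rt tt]] _] := has_sum_exchange cn (sum_le_mulr B0 alM) cr ct.
by transitivity t; [|symmetry]; exact: has_sum_zsum.
Qed.

Lemma aper_rep_ell1Z (a : int -> X -> C) w : ell1 a -> ell1Z w ->
  ell1Z (op a w).
Proof.
move=> ea lw; have bw := ell1Z_bounded lw; apply/ell1ZP.
have [W wW] := (ell1ZP w).1 lw.
have /(ell1P X0 cX)[_ [al [M [aal alM]]]] := ea.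
have al0 n : 0 <= al n by apply: le_trans (normc_ge0 _) (aal n x).
pose c n k := a n (homeo_iter s k x) * w (k - n).
have cn n : sum_bounded (c n) (al n * W).
  apply: sum_boundedZ (sum_bounded_reindex (h := fun l => l - n) _ wW) => //.
    by move=> k /=; rewrite [X in X <= _]normcM ler_wpM2r ?normc_ge0.
  exact: addIr.
exists (M * W).
apply: (@sum_bounded_rows _ _ _ (fun k n => c n k)); last first.
  by move=> k; exact: aper_rep_has_sum.
apply: sum_bounded_swap; apply: sum_bounded_double cn _.
exact: sum_le_mulr (sum_bounded_ge0 wW) alM.
Qed.
End Op.

(** * Neumann series for convolution *)

Section Neumann.
Variable R : realType.
Local Notation C := R[i].
Implicit Types (p r v z : int -> C) (P Q V : R).

Lemma conv_has_sum p r P Q l : sum_bounded p P -> sum_bounded r Q ->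
  has_sum (fun n => p n * r (l - n)) (zsum (fun n => p n * r (l - n))).
Proof.
move=> pP rQ; have Q0 := sum_bounded_ge0 rQ.
apply: (@sum_bounded_zsum _ _ (P * Q)); apply: sum_bounded_dom (sum_le_mulr Q0
  pP) => n.
by rewrite normcM ler_wpM2l ?normc_ge0// (sum_bounded_le _ rQ).
Qed.

Lemma conv_bounded p r P Q : sum_bounded p P -> sum_bounded r Q ->
  sum_bounded (fun l => zsum (fun n => p n * r (l - n))) (P * Q).
Proof.
move=> pP rQ; have Q0 := sum_bounded_ge0 rQ.
apply: (@sum_bounded_rows _ _ _ (fun l n => p n * r (l - n))); last first.
  by move=> l; exact: conv_has_sum pP rQ.
apply: (@sum_bounded_swap _ _ _ (fun n l => p n * r (l - n))).
apply: (@sum_bounded_double _ _ _ (fun n l => p n * r (l - n)) _ _ _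
  (sum_le_mulr Q0 pP)) => n.
apply: (sum_boundedZ (k := normc (p n)) _ _ (sum_bounded_reindex (h := fun l =>
  l - n) _ rQ)).
- exact: normc_ge0.
- by move=> l /=; rewrite normcM.
- exact: addIr.
Qed.

Lemma half_geometric_le (F : {fset nat}) : \sum_(m <- F) (2^-1 : R) ^+ m <= 2.
Proof.
have Fn : ([set` F] `<=` `I_(\max_(i <- F) i).+1)%classic.
  by move=> i /= iF; rewrite ltnS leq_bigmax_seq.
have := @lee_sum_fset_nat R (fun m => (2^-1 ^+ m)%:E) F _ xpredT _ Fn.
rewrite !sumEFin lee_fin => h; apply: le_trans (h _) _.
  by move=> i _; rewrite lee_fin exprn_ge0.
elim: (_.+1) => [|n IH]; first by rewrite big_nil.
have -> : forall n, \sum_(0 <= i < n) (2^-1 : R) ^+ i = 2 - 2 * 2^-1 ^+ n.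
  elim=> [|q IHq]; first by rewrite big_nil; ring.
  by rewrite big_nat_recr//= IHq exprS; field.
by rewrite gerBl mulr_ge0// exprn_ge0.
Qed.

(* [u] is the sum of the [U m], where [U m] is [v] convolved [m] times with
   [- r]. *)
Lemma neumann_series r v V : sum_bounded r 2^-1 -> sum_bounded v V ->
  exists u, (exists M, sum_bounded u M) /\
    forall l, has_sum (fun n => u n * r (l - n)) (v l - u l).
Proof.
move=> rb vV.
pose U := fix U (m : nat) : int -> C :=
  if m is m'.+1 then fun l => - zsum (fun n => U m' n * r (l - n)) else v.
have V0 := sum_bounded_ge0 vV.
have UV m : sum_bounded (U m) (2^-1 ^+ m * V).
  elim: m => [|m IH]; first by rewrite expr0 mul1r.
  rewrite exprSr mulrAC; apply: sum_boundedW (conv_bounded IH rb) => l.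
  by rewrite normcN.
have geo := sum_le_mulr V0 half_geometric_le.
have [u Uu] := choice (fun l => sum_bounded_has_sum (sum_bounded_col l UV geo)).
exists u; split.
  exists (2 * V); apply: (@sum_bounded_rows _ _ _ (fun l m => U m l)) Uu.
  by apply: (@sum_bounded_swap _ _ _ U); exact: sum_bounded_double UV geo.
(* Row [m] sums to [- U m.+1 l] and column [n] to [u n * r (l - n)]; exchanging the sums gives the
   equation for [u]. *)
move=> l; pose d m n := U m n * r (l - n).
have dm m : sum_bounded (d m) (2^-1 ^+ m * V).
  apply: sum_boundedW (UV m) => n; rewrite normcM ler_piMr ?normc_ge0//.
  by apply: le_trans (sum_bounded_le _ rb) _; lra.
have dr m : has_sum (d m) (- U m.+1 l).
  by rewrite /= opprK; exact: conv_has_sum (UV m) rb.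
have dc n : has_sum (d^~ n) (u n * r (l - n)).
  by rewrite mulrC; apply: has_sum_ext (has_sumZ _ (Uu n)) _ => m;
    rewrite mulrC.
have [[t [ht hu]] _] := has_sum_exchange dm geo dr dc.
suff -> : v l - u l = t by [].
apply: has_sum_unique ht.
(* Cancelling the term [m = 0], which is [v l], and reindexing by [succn] shows that the [U m.+1 l]
   sum to [u l - v l]. *)
have h1 : has_sum (fun m => if m == 0%N then - v l else 0) (- v l).
  have := @has_sum_single _ _ (fun m => if m == 0%N then - v l else 0) 0%N.
  by apply=> m /negbTE ->.
have := has_sum_reindex (h := succn) (g := predn) _ _ (has_sumD (Uu l) h1).
move=> /(_ succnK) h2.
have -> : v l - u l = -1 * (u l - v l) by ring.
apply: has_sum_ext (has_sumZ (-1) (h2 _)) _ => [[_|m]|m] /=.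
- by rewrite subrr.
- by rewrite eqxx.
- by rewrite addr0 mulN1r.
Qed.

(** Convolution with [z] is the identity plus convolution with an element of norm at most one half,
    hence onto by the Neumann series. *)
Lemma deconvolution z v V : sum_bounded (fun j => z j - (j == 0)%:R) 2^-1 ->
  sum_bounded v V ->
  exists u, (exists M, sum_bounded u M) /\
    forall l, has_sum (fun n => u n * z (l - n)) (v l).
Proof.
move=> zb vV; have [u [ub uz]] := neumann_series zb vV; exists u; split=> // l.
have h1 : has_sum (fun n => u n * (l - n == 0)%:R) (u l).
  have := @has_sum_single _ _ (fun n => u n * (l - n == 0)%:R) l.
  rewrite subrr eqxx mulr1; apply => n nl.
  by rewrite subr_eq0 eq_sym (negbTE nl) mulr0.
have := has_sumD (uz l) h1; rewrite subrK; move/has_sum_ext; apply => n.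
by rewrite -mulrDr subrK.
Qed.
End Neumann.

(** * Irreducibility *)

Section Periods.
Variables (X : topologicalType) (s : homeomorphism X).
Implicit Types (x : X) (p : nat).

Lemma homeo_iter_diff x (j k : int) :
  homeo_iter s j x = homeo_iter s k x -> homeo_iter s (j - k) x = x.
Proof. by move=> jk; rewrite addrC homeo_iterD jk -homeo_iterD addNr. Qed.

Lemma homeo_iter_mul x (q p : int) :
  homeo_iter s p x = x -> homeo_iter s (q * p) x = x.
Proof.
move=> px; have Npx : homeo_iter s (- p) x = x.
  by rewrite -[in LHS]px -homeo_iterD addNr.
elim/int_ind: q => [|q IH|q IH]; first by rewrite mul0r.
  by rewrite -addn1 PoszD mulrDl mul1r homeo_iterD px.
by rewrite -addn1 PoszD opprD mulrDl mulN1r homeo_iterD Npx.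
Qed.

Lemma homeo_iter_mod x p n : iter p.+1 s x = x ->
  homeo_iter s n x = iter `|(n %% p.+1)%Z|%N s x.
Proof.
move=> px.
rewrite [in LHS](divz_eq n p.+1) addrC homeo_iterD homeo_iter_mul//.
have : 0 <= (n %% p.+1)%Z by rewrite modz_ge0.
by case: (n %% p.+1)%Z.
Qed.

Lemma modz_lt_nat (n : int) p : (`|(n %% p.+1)%Z| < p.+1)%N.
Proof. by have := ltz_pmod n (ltn0Sn p : 0 < p.+1%:Z);
  rewrite -{1}(gez0_abs (modz_ge0 _ _))//. Qed.

Lemma iter_fix_Per x p : iter p.+1 s x = x -> Per s x.
Proof.
move=> px; apply: sub_finite_set (finite_image (fun r => iter r s x) (finite_II
  p.+1)).
move=> _ [n _ <-]; exists `|(n %% p.+1)%Z|%N; first exact: modz_lt_nat.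
by rewrite (homeo_iter_mod n px).
Qed.

Lemma Aper_inj x : Aper s x -> injective (homeo_iter s ^~ x).
Proof.
move=> ax j k /homeo_iter_diff; apply: contraPP => /eqP jk.
rewrite -subr_eq0 in jk => h; apply: ax.
have {}jk : (0 < `|j - k|)%N by rewrite absz_gt0.
(* Multiplying by the sign turns [j - k] into a positive return time. *)
have := homeo_iter_mul (Num.sg (j - k)) h; rewrite -normrEsg.
rewrite -abszE /=; case: `|j - k|%N jk => // p _; exact: iter_fix_Per.
Qed.

Lemma Per_has_period x : Per s x -> exists p, has_period s x p.+1.
Proof.
move=> fx.
have [|ex] := pselect (exists d, `[< iter d.+1 s x = x >]); last first.
  (* Without a return time, [n |-> iter n s x] would embed the natural numbers into the finite
     orbit. *)
  exfalso; apply: infinite_nat.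
  have -> : [set: nat] = (fun n => iter n s x) @^-1` Defs.orbit s x.
    by apply/seteqP; split => // n _; exists (Posz n).
  apply: finite_preimage fx => m n _ _ mn; apply/eqP; apply: contra_notT ex.
  wlog : m n mn / (m < n)%N => [h|mn0 _].
    by rewrite neq_ltn => /orP[mn0|mn0]; [apply: (h m n)|apply: (h n m)];
      rewrite ?mn0 ?neq_ltn ?mn0 ?orbT.
  exists (n - m).-1; apply/asboolP; rewrite prednK ?subn_gt0//.
  have := @homeo_iter_diff x n m; rewrite subzn ?(ltnW mn0)// => h.
  exact: h (esym mn).
move=> ex; case: (ex_minnP ex) => p /asboolP px pmin; exists p; split=> // q.
move=> /andP[q0 qp] qx; have /pmin : `[< iter q.-1.+1 s x = x >].
  by rewrite prednK//; apply/asboolP.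
by case: q q0 qp {qx} => //= q _; rewrite ltnS; case: ltngtP.
Qed.

Lemma has_period_dvd x p (m : int) : has_period s x p.+1 ->
  homeo_iter s m x = x -> (m %% p.+1)%Z = 0.
Proof.
move=> [_ px pmin]; rewrite (homeo_iter_mod _ px) => mx.
apply/eqP; rewrite -absz_eq0 -leqn0 leqNgt; apply/negP => m0.
by apply: (pmin _ _ mx); rewrite m0 modz_lt_nat.
Qed.

End Periods.

Section Transitive.
Variables (R : realType) (X : topologicalType) (s : homeomorphism X).
Local Notation C := R[i].
Hypotheses (X0 : [set: X] !=set0) (cX : compact [set: X]).
Hypothesis hX : hausdorff_space X.

Lemma urysohn_point (y : X) (B : set X) : finite_set B -> ~ B y ->
  exists g : X -> C, [/\ continuous (g : X -> C^o), g y = 1,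
    forall z, B z -> g z = 0 & forall z, normc (g z) <= 1].
Proof.
move=> fB By; have accX := hausdorff_accessible hX.
have [|f [cf f01 f0 f1]] := (@uniform_separatorP X R B [set y]).1 _.
  apply: (normal_separatorP (R := R)).1 => //.
  - exact: compact_normal.
  - exact: accessible_finite_set_closed.1.
  - exact: accessible_closed_set1.
  - by apply/seteqP; split => // z [] /= Bz zy; rewrite zy in Bz.
exists (fun z => (f z)%:C); split.
- move=> z; apply/(@cvgrPdist_lt _ C^o _ _ (nbhs_filter z)) => e e0.
  have Ree : e = (complex.Re e)%:C by rewrite RRe_real// gtr0_real.
  have e0' : 0 < complex.Re e by rewrite -ltcR -Ree.
  have := (@cvgrPdist_lt _ R^o _ _ (nbhs_filter z) _ _).1 (cf z) _ e0'.
  apply: filterS => t; move=> /= h; have : normc ((f z)%:C - (f t)%:C) <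
    complex.Re e.
    have -> : (f z)%:C - (f t)%:C = (f z - f t)%:C by rewrite rmorphB.
    by rewrite normc_real.
  by rewrite -ltcR -Ree.
- by have -> : f y = 1 by apply: f1; exists y.
- by move=> z Bz; have -> : f z = 0 by apply: f0; exists z.
- move=> z; have : f z \in `[0, 1]%R by apply: f01; exists z.
  by rewrite normc_real in_itv/= => /andP[h0 h1]; rewrite ger0_norm.
Qed.

(** The product of [\sum_n u_n delta^n] with [g], since [delta^n g = (g o sigma^(-n)) delta^n]: it
    acts by multiplying by the values of [g] along the orbit, then convolving with [u]. *)
Definition twist (u : int -> C) (g : X -> C) : int -> X -> C :=
  fun n y => u n * g (homeo_iter s (- n) y).

Lemma twist_ell1 u g M : sum_bounded u M -> continuous (g : X -> C^o) ->
  (forall y, normc (g y) <= 1) -> ell1 (twist u g).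
Proof.
move=> uM cg g1; apply/(ell1P X0 cX); split.
  move=> n y; apply: (@cvgM C^o); first exact: cvg_cst.
  apply: continuous_comp; [exact: homeo_iter_continuous|exact: cg].
exists (fun n => normc (u n)), M; split=> // n y.
by rewrite normcM ler_piMr ?normc_ge0.
Qed.

Lemma twist_has_sum x u g M w l : sum_bounded u M ->
  continuous (g : X -> C^o) -> (forall y, normc (g y) <= 1) -> bounded_seq w ->
  has_sum (fun n => u n * (g (homeo_iter s (l - n) x) * w (l - n)))
    (aper_rep s x (twist u g) w l).
Proof.
move=> uM cg g1 bw.
have := aper_rep_has_sum s X0 cX x l (twist_ell1 uM cg g1) bw.
move/has_sum_ext; apply => n.
by rewrite /twist -homeo_iterD addrC mulrA.
Qed.

(** Multiplication by [g] keeps the coordinate [k] of [w], kills the others in [F] and leaves a tail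
    of at most half the size; the result is a shifted multiple of an invertible convolver.
    Aperiodicity keeps [sigma^k x] apart from the points to be killed. *)
Lemma aper_rep_transitive x (v w : int -> C) : Aper s x -> ell1Z w ->
  w <> 0 -> ell1Z v -> exists2 a, ell1 a & aper_rep s x a w = v.
Proof.
move=> /Aper_inj xI lw w0 /ell1ZP[V vV]; have bw := ell1Z_bounded lw.
have [W wW] := (ell1ZP w).1 lw.
have [k wk] : exists k, w k != 0.
  by apply/not_existsP => h; apply: w0; apply/funext => k;
    apply/eqP/negPn/negP; exact: h.
have nwk : 0 < normc (w k).
  by rewrite lt_neqAle normc_ge0 andbT eq_sym;
    apply: contra wk => /eqP/eq0_normc ->.
have [|F HF] := sum_bounded_tail (e := normc (w k) / 2) _ wW;
  first by rewrite divr_gt0.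
have [||g [cg gk gF g1]] := @urysohn_point (homeo_iter s k x)
    [set homeo_iter s j x | j in [set` F] `\ k].
- by apply: finite_image; apply: finite_setD.
- by move=> [j [_ /= jk] /xI].
(* The product of [g] and [w] along the orbit, moved from [k] to 0 and scaled to have value 1
   there. *)
pose z j := g (homeo_iter s (j + k) x) * w (j + k) / w k.
(* The part of [w] outside [F] and [k]; divided by [w k], it dominates the error of [z] against the
   unit sequence at 0. *)
pose c i := if (i == k) || (i \in F) then 0 else w i.
have cb : sum_bounded c (normc (w k) / 2).
  move=> G; rewrite -(@big_fset_incl _ _ _ _ (G `\` F)%fset)/=; first last.
  - move=> n nG; rewrite inE nG andbT negbK /c => ->.
    by rewrite orbT normc0.
  - exact: fsubsetDl.
  apply: le_trans (HF (G `\` F)%fset _); last first.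
    by apply/fdisjointP => n nF; rewrite inE nF.
  by apply: ler_sum => n _; rewrite /c; case: ifP; rewrite ?normc0 ?normc_ge0.
have zb : sum_bounded (fun j => z j - (j == 0)%:R) 2^-1.
  have -> : 2^-1 = (normc (w k))^-1 * (normc (w k) / 2) :> R.
    by rewrite mulrA mulVf ?mul1r// gt_eqF.
  apply: sum_boundedZ (sum_bounded_reindex (h := fun j => j + k) _ cb).
  - by rewrite invr_ge0 normc_ge0.
  - move=> j /=; have -> : c (j + k) = if (j == 0) || (j + k \in F) then 0 else
    w (j + k).
      by rewrite /c -subr_eq0 addrK.
    rewrite /z.
    have [->|j0] := eqVneq j 0.
      by rewrite add0r gk mul1r divff// subrr normc0 mulr0.
    rewrite subr0 !normcM normcV mulrC ler_pM2l ?invr_gt0//=.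
    case: ifP => [jF|_]; last by rewrite ler_piMl ?normc_ge0.
    rewrite gF ?normc0 ?mul0r//; exists (j + k) => //; split=> //= jk.
    by move: j0; rewrite -(addKr k j) addrC -[k + j]addrC jk subrr eqxx.
  - exact: addIr.
have [u [[M uM] uz]] := deconvolution zb vV.
have ub : sum_bounded (fun n => u (n + k) / w k) ((normc (w k))^-1 * M).
  apply: sum_boundedZ (sum_bounded_reindex (h := fun j => j + k) _ uM).
  - by rewrite invr_ge0 normc_ge0.
  - by move=> j /=; rewrite normcM normcV mulrC.
  - exact: addIr.
(* The change in [u] undoes the shift by [k] and the division by [w k] built into [z]. *)
exists (twist (fun n => u (n + k) / w k) g); first exact: twist_ell1 ub cg g1.
apply/funext => l; apply: has_sum_unique (twist_has_sum x l ub cg g1 bw) _.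
have := has_sum_reindex (h := fun n => n + k) (g := fun n => n - k) _ _ (uz l).
move=> h; apply: has_sum_ext (h _ _) _ => [n|n|n /=].
- exact: addrK.
- by rewrite subrK eqxx.
- by rewrite /z (_ : l - (n + k) + k = l - n); [field|ring].
Qed.
End Transitive.

(** * Quasi-periodic sequences over a finite orbit *)

Section QuasiPeriodic.
Variable R : realType.
Local Notation C := R[i].
Implicit Types (p : nat) (lam : C) (w : int -> C).

(** The side on which [lam] stands matches [delta e_(p-1) = lambda e_0]: the shifted sequence has
    value [w (-1) = lam * w (p - 1)] at 0. *)
Definition quasi_periodic p lam : set (int -> C) :=
  [set w | forall k : int, w k = lam * w (k + p)].

Lemma quasi_periodic_iter p lam w (q k : int) : lam != 0 ->
  quasi_periodic p lam w -> w k = lam ^ q * w (k + q * p).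
Proof.
move=> l0 wl; elim/int_ind: q k => [k|q IH k|q IH k].
- by rewrite expr0z mul1r mul0r addr0.
- rewrite -addn1 PoszD IH expfzDr// -mulrA expr1z (wl (k + q * p)).
  by rewrite mulrDl mul1r addrA.
- rewrite -addn1 PoszD opprD IH expfzDr// -mulrA; congr (_ * _).
  rewrite [RHS](_ : _ = lam^-1 * w (k + - q%:Z * p - p%:Z)); last first.
    by rewrite mulrDl mulN1r addrA.
  by rewrite (wl (k + - q%:Z * p - p%:Z)) mulKf// subrK.
Qed.

Lemma quasi_periodic_bounded p lam w : `|lam| = 1 ->
  quasi_periodic p.+1 lam w -> bounded_seq w.
Proof.
move=> l1 wl; exists (\sum_(j < p.+1) normc (w j)) => k.
have l0 : lam != 0 by rewrite -normr_eq0 l1 oner_eq0.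
rewrite (quasi_periodic_iter (- (k %/ p.+1)%Z) k l0 wl) normcM.
rewrite (normc_circle (norm_exprz1 _ l1)) mul1r mulNr.
have -> : k - (k %/ p.+1)%Z * p.+1 = `|(k %% p.+1)%Z|%N.
  by rewrite gez0_abs ?modz_ge0// {1}(divz_eq k p.+1) addrAC subrr add0r.
rewrite (bigD1 (Ordinal (modz_lt_nat k p)))//= lerDl.
by apply: sumr_ge0 => j _; exact: normc_ge0.
Qed.

Lemma quasi_periodic_exp p (om : C) : om != 0 ->
  quasi_periodic p (om ^ p) (fun k => om ^ (- k)).
Proof. by move=> om0 k; rewrite -expfzDr// opprD addrCA subrr addr0. Qed.

Lemma quasi_periodic_shift p lam w (n : int) : quasi_periodic p lam w ->
  quasi_periodic p lam (fun k => w (k - n)).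
Proof. by move=> wl k /=; rewrite (wl (k - n)) addrAC. Qed.

Variables (X : topologicalType) (s : homeomorphism X).
Hypotheses (X0 : [set: X] !=set0) (cX : compact [set: X]).
Hypothesis hX : hausdorff_space X.

Lemma aper_rep_quasi_periodic x p lam (a : int -> X -> C) w :
  iter p.+1 s x = x -> `|lam| = 1 -> ell1 a ->
  quasi_periodic p.+1 lam w -> quasi_periodic p.+1 lam (aper_rep s x a w).
Proof.
move=> px l1 ea wl k; have bw := quasi_periodic_bounded l1 wl.
apply: has_sum_zsum; have := aper_rep_has_sum s X0 cX x (k + p.+1) ea bw.
move=> /(has_sumZ lam)/has_sum_ext; apply => n.
have -> : homeo_iter s (k + p.+1) x = homeo_iter s k x.
  by rewrite homeo_iterD /= [s _]px.
by rewrite /aper_rep_fun /aper_rep_delta mulrCA (wl (k - n)) addrAC.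
Qed.

Lemma aper_rep_transitive_per x p lam (v w : int -> C) : has_period s x p.+1 ->
  `|lam| = 1 -> quasi_periodic p.+1 lam w -> w <> 0 ->
  quasi_periodic p.+1 lam v -> exists2 a, ell1 a & aper_rep s x a w = v.
Proof.
move=> hp l1 wl w0 vl; have [_ px _] := hp.
have l0 : lam != 0 by rewrite -normr_eq0 l1 oner_eq0.
have bw := quasi_periodic_bounded l1 wl.
have [k wk] : exists k, w k != 0.
  by apply/not_existsP => h; apply: w0; apply/funext => k;
    apply/eqP/negPn/negP; exact: h.
have [||g [cg gk gF g1]] := @urysohn_point R X cX hX (homeo_iter s k x)
    (Defs.orbit s x `\ homeo_iter s k x).
- by apply: finite_setD; exact: iter_fix_Per px.
- by move=> [_]; exact.
(* One exponent for each residue modulo [p.+1]: the power [n] carries the isolated coordinate [k] to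
   [k + n], where the value [v (k + n)] is wanted. *)
pose u (n : int) := if (0 <= n) && (n < p.+1) then v (k + n) / w k else 0.
have uM : sum_bounded u (\sum_(n <- [fset Posz (nat_of_ord i) | i in
  'I_p.+1]%fset) normc (u n)).
  apply: sum_bounded_finsupp => n; apply: contraNeq; rewrite /u.
  case: ifP; last by rewrite eqxx.
  case: n => // n /andP[_ np] _; apply/imfsetP.
  by exists (Ordinal (np : (n < p.+1)%N)).
exists (twist s u g); first exact: twist_ell1 uM cg g1.
apply/funext => l; apply: has_sum_unique (twist_has_sum s X0 cX x l uM cg g1
  bw) _.
pose n0 := ((l - k) %% p.+1)%Z; pose q := ((l - k) %/ p.+1)%Z.
have lE : l = k + n0 + q * p.+1.
  by rewrite -addrA [n0 + _]addrC -divz_eq addrC subrK.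
have -> : v l = u n0 * (g (homeo_iter s (l - n0) x) * w (l - n0)).
  have -> : l - n0 = k + q * p.+1 by rewrite lE; ring.
  rewrite homeo_iterD homeo_iter_mul// gk mul1r /u modz_ge0// ltz_pmod//=.
  rewrite {1}(quasi_periodic_iter q k l0 wl) {1}lE.
  rewrite (quasi_periodic_iter q (k + n0) l0 vl) invfM.
  have : w (k + q * p.+1) != 0.
    by apply: contra wk; rewrite (quasi_periodic_iter q k l0 wl) => /eqP ->;
      rewrite mulr0.
  have : lam ^ q != 0 by rewrite expfz_neq0.
  by set a := lam ^ q; set b := w _; set c := v _ => *; field; apply/andP.
(* For any other exponent in the support of [u], the orbit point at [l - n] differs from the one at
   [k] by minimality of the period, so [g] vanishes there. *)
apply: (has_sum_single (c := fun n => u n * (g (homeo_iter s (l - n) x) * w (l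
  - n)))) => n nn0.
rewrite /u; case: ifP => [/andP[n_ge0 n_lt]|]; last by rewrite mul0r.
rewrite gF ?mul0r ?mulr0//; split; first by exists (l - n).
move=> /homeo_iter_diff/(has_period_dvd hp) h.
move/eqP: nn0; apply; rewrite /n0.
have -> : l - k = (l - n - k) + n by ring.
by rewrite -modzDml h add0r modz_small// n_ge0.
Qed.
End QuasiPeriodic.

(** * The matrix representations *)

Section Matrix.
Variables (R : realType) (p : nat) (lam : R[i]).
Local Notation C := R[i].
Hypothesis l1 : `|lam| = 1.
Implicit Types (w : int -> C) (v : 'cV[C]_p.+1).

Definition window w : 'cV[C]_p.+1 := \col_(j < p.+1) w j.

(** The inverse of [window] on quasi-periodic sequences: for [k = q * p.+1 + r] the value is
    [lam ^ (- q)] times the [r]-th entry. *)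
Definition extend v : int -> C :=
  fun k => lam ^ (- (k %/ p.+1)%Z) * v (inord `|(k %% p.+1)%Z|) 0.

Let l0 : lam != 0.
Proof. by rewrite -normr_eq0 l1 oner_eq0. Qed.

Lemma extend_quasi_periodic v : quasi_periodic p.+1 lam (extend v).
Proof.
move=> k; rewrite /extend modzDr divzDr ?dvdzz// divzz/= mulrA.
by congr (_ * _); rewrite opprD expfzDr// mulrCA divff// mulr1.
Qed.

Lemma extendK v : window (extend v) = v.
Proof.
apply/colP => j; rewrite mxE /extend.
have jp : 0 <= (j : int) < p.+1 by rewrite /= ltz_nat ltn_ord.
by rewrite divz_small// modz_small// oppr0 expr0z mul1r /= inord_val.
Qed.

Lemma windowK w : quasi_periodic p.+1 lam w -> extend (window w) = w.
Proof.
move=> wl; apply/funext => k; rewrite /extend mxE inordK ?modz_lt_nat//.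
rewrite (quasi_periodic_iter (- (k %/ p.+1)%Z) k l0 wl) mulNr; congr (_ * w _).
by rewrite gez0_abs ?modz_ge0// {2}(divz_eq k p.+1) addrAC subrr add0r.
Qed.

Lemma extend_sum v k :
  extend v k = \sum_(j < p.+1) v j 0 * extend (delta_mx j 0) k.
Proof.
rewrite /extend; set r := inord _; set q := lam ^ _.
rewrite (bigD1 r)//= !mxE !eqxx/= mulr1 mulrC big1 ?addr0// => j jr.
by rewrite mxE eq_sym (negbTE jr) mulr0 mulr0.
Qed.

Local Notation delta := (per_rep_delta p lam).

Lemma delta_window w : quasi_periodic p.+1 lam w ->
  delta *m window w = window (fun k => w (k - 1)).
Proof.
move=> wl; apply/colP => i; rewrite !mxE big_ord_recr/= !mxE eqxx.
case: i => [[|i] ip] /=.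
  (* Row 0 meets only the last column, and [lam * w p] is [w (-1)] by quasi-periodicity. *)
  rewrite big1 => [|j _]; last by rewrite !mxE -val_eqE/= ltn_eqF ?mul0r//
    ltn_ord.
  by rewrite add0r mulr1 (wl (0 - 1)); congr (_ * w _); lia.
have jp : (i < p)%N by [].
rewrite (bigD1 (Ordinal jp))//= !mxE -!val_eqE/= ltn_eqF// eqxx mul1r.
rewrite mulr0 mul0r addr0 big1 ?addr0 => [|j ji]; first by congr w; lia.
rewrite !mxE -val_eqE/= ltn_eqF ?ltn_ord// eqSS.
by move: ji; rewrite -val_eqE/= eq_sym => /negbTE ->; rewrite mul0r.
Qed.

Lemma delta_unit : delta \is a GRing.unit.
Proof.
(* [B] is the matrix of the backward shift in the basis of windows. *)
pose B : 'M[C]_p.+1 := \matrix_(i, j) extend (delta_mx j 0) (i%:Z + 1).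
suff /mulmx1_unit[] : delta *m B = 1%:M by [].
apply/matrixP => i j.
have := delta_window (quasi_periodic_shift (-1) (extend_quasi_periodic
  (delta_mx j 0))).
move=> /matrixP/(_ i 0); rewrite [RHS]mxE opprK subrK.
have /matrixP/(_ i 0) := extendK (delta_mx j 0); rewrite [LHS]mxE => ->.
rewrite !mxE eqxx andbT => <-; apply: eq_bigr => k _.
by rewrite !mxE.
Qed.

Lemma delta_exp_window w (n : int) : quasi_periodic p.+1 lam w ->
  delta ^ n *m window w = window (fun k => w (k - n)).
Proof.
have pos (m : nat) u : quasi_periodic p.+1 lam u ->
    delta ^+ m *m window u = window (fun k => u (k - m%:Z)).
  elim: m u => [|m IH] u ul.
    by rewrite expr0 mul1mx; congr window; apply/funext => k; rewrite subr0.
  rewrite exprSr -mulmxE -mulmxA delta_window//.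
  rewrite (IH _ (quasi_periodic_shift 1 ul)).
  by congr window; apply/funext => k; congr u; lia.
move=> wl; case: n => m; first exact: pos.
rewrite NegzE -exprnN.
(* For a negative exponent, [window w] is written as the opposite positive power applied to the
   target window, and the powers cancel. *)
have -> : window w = delta ^+ m.+1 *m window (fun k => w (k - - m.+1%:Z)).
  rewrite (pos _ _ (quasi_periodic_shift (- m.+1%:Z) wl)).
  by congr window; apply/funext => k; congr w; lia.
by rewrite mulmxA mulmxE mulVr ?mul1mx// unitrX// delta_unit.
Qed.

Variables (X : topologicalType) (s : homeomorphism X).
Hypotheses (X0 : [set: X] !=set0) (cX : compact [set: X]).

Lemma per_repE x (a : int -> X -> C) i j :
  per_rep s x p lam a i j = aper_rep s x a (extend (delta_mx j 0)) i.
Proof.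
rewrite mxE /aper_rep; congr zsum; apply/funext => n.
rewrite mul_diag_mx !mxE; congr (_ * _).
have /matrixP/(_ i 0) := delta_exp_window n (extend_quasi_periodic (delta_mx j
  0)).
rewrite extendK [RHS]mxE /aper_rep_delta => <-.
by rewrite -colE mxE.
Qed.

(** [extend] and [window] intertwine the matrix representation with the sequence operator, so the
    kernel of the former can be studied on quasi-periodic sequences. *)
Lemma per_rep_mulmx x (a : int -> X -> C) v : ell1 a ->
  per_rep s x p lam a *m v = window (aper_rep s x a (extend v)).
Proof.
move=> ea; apply/colP => i; rewrite !mxE; symmetry.
have bv u := quasi_periodic_bounded l1 (extend_quasi_periodic u).
apply: has_sum_unique (aper_rep_has_sum s X0 cX x i ea (bv v)) _.
have := has_sum_sum (index_enum 'I_p.+1) (fun j => has_sumZ (v j 0)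
  (aper_rep_has_sum s X0 cX x i ea (bv (delta_mx j 0)))).
under [X in has_sum _ X]eq_bigr do rewrite -per_repE mulrC.
move/has_sum_ext; apply => n; rewrite extend_sum mulr_sumr.
by apply: eq_bigr => j _; rewrite mulrCA.
Qed.
End Matrix.

(** * The Jacobson radical *)

Section Submodule.
Variables (K : fieldType) (U : lmodType K) (P : pred U).

(* The closure proof is a phantom argument, so that the module structure can be
   inferred from the type. *)
Definition submodule_of of submod_closed P : Type := {u : U | P u}.

Variable P_closed : submod_closed P.
HB.instance Definition _ := [isSub of submodule_of P_closed for @sval U P].
HB.instance Definition _ := [Choice of submodule_of P_closed by <:].
HB.instance Definition _ := GRing.SubChoice_isSubLmodule.Build K U P
  (submodule_of P_closed) P_closed.
End Submodule.

Section Jacobson.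
Variables (K : fieldType) (A U : lmodType K) (S : set A) (mul : A -> A -> A).
Variables (pi : A -> U -> U) (P : set U).
Hypotheses (P0 : P 0)
  (P_lin : forall (c : K) u v, P u -> P v -> P (c *: u + v))
  (P_pi : forall a v, S a -> P v -> P (pi a v))
  (pi_lin : forall a (c : K) u v, S a -> P u -> P v ->
     pi a (c *: u + v) = c *: pi a u + pi a v)
  (pi_add : forall (c : K) a b v, S a -> S b -> P v ->
     pi (c *: a + b) v = c *: pi a v + pi b v)
  (pi_mul : forall a b v, S a -> S b -> P v -> pi (mul a b) v = pi a (pi b v))
  (pi_trans : forall w v, P w -> w <> 0 -> P v -> exists2 a, S a & pi a w = v).

(** Transitivity on non-zero vectors makes the restriction of [pi] to [P] algebraically irreducible,
    so the radical kills it. All hypotheses are relative to [P], since operators given by series are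
    controlled only there. *)
Lemma jacobson_radical_transitive a v :
  jacobson_radical S mul a -> P v -> pi a v = 0.
Proof.
move=> [Sa ja] Pv; have [v0|v0] := pselect (v = 0).
  have := pi_lin (-1) Sa Pv Pv.
  by rewrite v0 scaler0 add0r scaleN1r addNr.
pose Pb : pred U := fun u => `[< P u >].
have Psub : submod_closed Pb.
  split; first exact/asboolP.
  by move=> c x y /asboolP Px /asboolP Py; apply/asboolP; exact: P_lin.
pose V : lmodType K := submodule_of Psub.
have PV (u : V) : P (val u) by apply/asboolP; exact: valP u.
(* The default 0 is never reached for [b] in [S], because [P] is stable under [pi b]. *)
pose restr (b : A) (u : V) : V := insubd 0 (pi b (val u)).
have restrE b (u : V) : P (pi b (val u)) -> val (restr b u) = pi b (val u).
  by move=> Pbu; rewrite val_insubd ifT//; exact/asboolP.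
have val_lin (c : K) (u w : V) : val (c *: u + w) = c *: val u + val w.
  exact: linearP.
have PpiV b (u : V) : S b -> P (pi b (val u)) by move=> Sb;
  exact: P_pi Sb (PV u).
have restr_rep : representation S mul restr.
  split=> [b Sb c u w|c b d Sb Sd u|b d Sb Sd u]; apply: val_inj.
  - rewrite val_lin !restrE; [|exact: PpiV..].
    by rewrite val_lin; apply: pi_lin => //; exact: PV.
  - have E : pi (c *: b + d) (val u) = c *: pi b (val u) + pi d (val u).
      exact: pi_add Sb Sd (PV u).
    rewrite val_lin !restrE ?E//; try exact: PpiV.
    by apply: P_lin; exact: PpiV.
  - have E : pi (mul b d) (val u) = pi b (val (restr d u)).
      by rewrite restrE ?(pi_mul Sb Sd (PV u))//; exact: PpiV.
    by rewrite (restrE (mul b d)) E ?(restrE b)//; exact: PpiV.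
have restr_irr : alg_irreducible S restr.
  split.
    (* The representation is non-zero because some [b] carries [v] to itself. *)
    have [b Sb bv] := pi_trans Pv v0 Pv.
    exists b, (insubd 0 v); split=> // /(congr1 val).
    have vv : val (insubd (0 : V) v) = v by rewrite val_insubd ifT//;
      exact/asboolP.
    by rewrite restrE vv bv.
  move=> W [W0 Wlin Wpi].
  have [[w Ww w0]|W1] := pselect (exists2 w, W w & w <> 0); [right|left].
    apply/seteqP; split=> // u _.
    have [|b Sb bw] := pi_trans (PV w) _ (PV u).
      by move=> h; apply: w0; apply: val_inj.
    have -> : u = restr b w by apply: val_inj; rewrite restrE bw.
    exact: Wpi.
  apply/seteqP; split=> [u Wu|_ ->//].
  by apply: contra_notP W1 => u0; exists u.
have [_ /(_ (insubd 0 v))/(congr1 val)] := ja V restr restr_rep restr_irr.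
have vv : val (insubd (0 : V) v) = v by rewrite val_insubd ifT//; exact/asboolP.
by rewrite restrE vv//; exact: P_pi.
Qed.
End Jacobson.

(** * Vanishing of the coefficients and semisimplicity *)

Section Main.
Variables (R : realType) (X : topologicalType) (s : homeomorphism X).
Local Notation C := R[i].
Hypotheses (X0 : [set: X] !=set0) (cX : compact [set: X]).
Hypothesis hX : hausdorff_space X.
Implicit Types (a : int -> X -> C) (x : X).

Lemma exp_bounded_seq (om : C) : `|om| = 1 -> bounded_seq (fun k => om ^ (- k)).
Proof. by move=> om1; exists 1 => k; rewrite normc_circle// norm_exprz1. Qed.

Lemma aper_rep_exp a x (om : C) i : ell1 a -> `|om| = 1 ->
  aper_rep s x a (fun k => om ^ (- k)) i = 0 ->
  has_sum (fun n => a n (homeo_iter s i x) * om ^ n) 0.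
Proof.
move=> ea om1 h; have om0 : om != 0 by rewrite -normr_eq0 om1 oner_eq0.
have := has_sumZ (om ^ i) (aper_rep_has_sum s X0 cX x i ea (exp_bounded_seq
  om1)).
rewrite h mulr0; move/has_sum_ext; apply => n.
by rewrite mulrCA -expfzDr// subKr.
Qed.

Lemma aper_rep_basis a x (i n : int) :
  aper_rep s x a (fun m => (m == i - n)%:R) i = a n (homeo_iter s i x).
Proof.
apply: has_sum_zsum.
have := @has_sum_single _ _ (fun m : int => a m (homeo_iter s i x) * (i - m ==
  i - n)%:R) n.
rewrite eqxx mulr1; apply => m mn.
by rewrite (inj_eq (addrI i)) eqr_opp (negbTE mn) mulr0.
Qed.

Lemma delta_ell1Z (j : int) : ell1Z (fun m => (m == j)%:R : C).
Proof.
apply/ell1ZP; exists (\sum_(m <- [fset j]%fset) normc ((m == j)%:R : C)).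
by apply: sum_bounded_finsupp => m; rewrite inE => /negbTE ->.
Qed.

(** The criterion shared by the intersection formula and semisimplicity; Fourier uniqueness is
    applied at each periodic point separately. *)
Lemma ell1_eq0 a : ell1 a ->
  (forall x p (om : C), has_period s x p.+1 -> `|om| = 1 ->
     has_sum (fun n => a n x * om ^ n) 0) ->
  (forall x n, Aper s x -> a n x = 0) -> a = 0.
Proof.
move=> /(ell1P X0 cX)[_ [al [M [aal alM]]]] per aper.
apply/funext => n; apply/funext => x.
have [px|] := pselect (Per s x); last exact: aper.
have [p hp] := Per_has_period px.
apply: (@fourier_unique R (fun n => a n x) M); first exact: sum_bounded_dom alM.
by move=> om om1; exact: per hp om1.
Qed.

Lemma Per_closure x : Per s x -> closure (Defs.orbit s x) = Defs.orbit s x.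
Proof.
move=> px; rewrite -(closure_id _).1//.
exact: (accessible_finite_set_closed.1 (hausdorff_accessible hX)).
Qed.

Lemma has_period_orbit x y p q : has_period s x p.+1 -> has_period s y q.+1 ->
  Defs.orbit s x y -> (p.+1 %| q.+1)%N.
Proof.
move=> hp [_ qy _] [t _ ty].
suff /(has_period_dvd hp)/dvdz_mod0P : homeo_iter s q.+1 x = x by [].
have -> : x = homeo_iter s (- t) y by rewrite -ty -homeo_iterD addNr.
by rewrite -homeo_iterD addrC homeo_iterD /= [s _]qy.
Qed.

(** The kernel is given through some point [y] of the orbit of [x], with its own period [q.+1]. The
    two periods divide each other, and the value at [x] is read from a suitable coordinate over
    [y]. *)
Lemma P_per_fourier a x p (om : C) : has_period s x p.+1 -> `|om| = 1 ->
  P_per s (closure (Defs.orbit s x)) (om ^+ p.+1) a ->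
  has_sum (fun n => a n x * om ^ n) 0.
Proof.
move=> hp om1 [y [q [py hq Oxy [ea ka]]]].
have px : Per s x by case: hp => _ hp _; exact: iter_fix_Per hp.
move: Oxy; rewrite !Per_closure// => Oxy.
have xy : Defs.orbit s x y by rewrite Oxy; exists 0.
have [t _ yx] : Defs.orbit s y x by rewrite -Oxy; exists 0.
have pq : p = q.
  apply/eqP; rewrite -eqSS eqn_dvd (has_period_orbit hp hq)//.
  by rewrite (has_period_orbit hq hp)//; exists t.
subst q; have om0 : om != 0 by rewrite -normr_eq0 om1 oner_eq0.
have l1 : `|om ^+ p.+1| = 1 by rewrite normrX om1 expr1n.
have wl := quasi_periodic_exp p.+1 om0.
have := ka (window p (fun k => om ^ (- k))).
rewrite per_rep_mulmx// windowK// => /matrixP h.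
have [_ fy _] := hq; rewrite -yx (homeo_iter_mod t fy).
(* Since [x = sigma^t y], the coordinate is [t] modulo the period rather than 0. *)
apply: (@aper_rep_exp a y om `|(t %% p.+1)%Z|%N) => //.
by have := h (Ordinal (modz_lt_nat t p)) 0; rewrite !mxE.
Qed.

(** The witness [y] need not lie on the orbit of [x], only share its closure. The zero set of [a n]
    is closed and contains the orbit of [y], hence also [x]. *)
Lemma P_aper_eq0 a x n : P_aper s (closure (Defs.orbit s x)) a -> a n x = 0.
Proof.
move=> [ea [y [_ Oxy ka]]].
have [ca _] := (ell1P X0 cX a).1 ea.
have cl : closed [set z | a n z = 0].
  apply: (@closed_comp _ C^o (a n) [set 0]) => [z _|]; first exact: ca.
  by apply: accessible_closed_set1; apply: hausdorff_accessible;
    exact: norm_hausdorff.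
suff le : closure (Defs.orbit s y) `<=` [set z | a n z = 0].
  by apply: le; rewrite -Oxy; apply: subset_closure; exists 0.
rewrite [X in _ `<=` X](closure_id _).1//; apply: closureS => _ [k _ <-] /=.
by rewrite -(aper_rep_basis a y k n) ka//; exact: delta_ell1Z.
Qed.

Lemma ell1_0 : ell1 (0 : int -> X -> C).
Proof.
apply/(ell1P X0 cX); split; first by move=> n; exact: cst_continuous.
by exists (fun=> 0), 0; split=> [n y|F]; rewrite ?normc0// big1.
Qed.

Lemma aper_rep0 x w : aper_rep s x (0 : int -> X -> C) w = 0.
Proof.
apply/funext => k; apply: has_sum_zsum.
by apply: has_sum_ext (@has_sum0 R int) _ => n; rewrite /aper_rep_fun mul0r.
Qed.

Lemma ell1_semisimple : semisimple (@ell1 R X) (@ell1_mul R X s).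
Proof.
apply/seteqP; split=> [a ja|_ ->]; last first.
  split=> [|V pi repi _]; first exact: ell1_0.
  split=> [|v]; first exact: ell1_0.
  (* Additivity gives [pi 0 v = pi 0 v + pi 0 v], so 0 lies in every kernel. *)
  have := rep_linear repi 1 ell1_0 ell1_0 v.
  rewrite scaler0 add0r scale1r => h; apply: (@addrI _ (pi 0 v)).
  by rewrite addr0 -h.
have [ea _] := ja; apply: ell1_eq0 => // [x p om hp om1|x n ax].
  have om0 : om != 0 by rewrite -normr_eq0 om1 oner_eq0.
  have [_ px _] := hp.
  have l1 : `|om ^+ p.+1| = 1 by rewrite normrX om1 expr1n.
  apply: (@aper_rep_exp a x om 0) => //.
  (* Periodic case: the space is that of quasi-periodic sequences for [om ^+ p.+1], which contains
     [k |-> om ^ (- k)]. *)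
  rewrite (@jacobson_radical_transitive _ _ _ _ _ (aper_rep s x)
    (quasi_periodic p.+1 (om ^+ p.+1)) _ _ _ _ _ _ _ _ _ ja)//.
  - by move=> k; rewrite mulr0.
  - move=> c u v ul vl k.
    have -> : (c *: u + v) (k + p.+1) = c * u (k + p.+1) + v (k + p.+1) by [].
    by rewrite mulrDr mulrCA -ul -vl.
  - by move=> b v eb vl; exact: aper_rep_quasi_periodic.
  - by move=> b c u v eb ul vl; apply: aper_rep_linear => //;
    exact: quasi_periodic_bounded l1 _.
  - by move=> c b d v eb ed vl; apply: aper_repD => //;
    exact: quasi_periodic_bounded l1 vl.
  - by move=> b d v eb ed vl; apply: aper_rep_mul => //;
    exact: quasi_periodic_bounded l1 vl.
  - by move=> w v wl w0 vl; exact: aper_rep_transitive_per hp _ wl w0 vl.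
  - exact: quasi_periodic_exp.
(* Aperiodic case: [a n x] is the coordinate 0 of the image of the basis vector at [- n] in
   [ell1Z]. *)
rewrite -[x]/(homeo_iter s 0 x) -(aper_rep_basis a x 0 n).
rewrite (@jacobson_radical_transitive _ _ _ _ _ (aper_rep s x)
    (@ell1Z R) _ _ _ _ _ _ _ _ _ ja)//.
- apply/ell1ZP; exists 0 => F; rewrite big1// => i _; exact: normc0.
- move=> c u v /ell1ZP[M uM] /ell1ZP[N vN]; apply/ell1ZP;
  exists (normc c * M + N).
  apply: sum_boundedD vN; apply: sum_boundedZ uM; first exact: normc_ge0.
  by move=> i; rewrite -normcM.
- by move=> b v eb lv; exact: aper_rep_ell1Z.
- by move=> b c u v eb lu lv; apply: aper_rep_linear => //;
  exact: ell1Z_bounded.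
- by move=> c b d v eb ed lv; apply: aper_repD => //; exact: ell1Z_bounded.
- by move=> b d v eb ed lv; apply: aper_rep_mul => //; exact: ell1Z_bounded.
- by move=> w v lw w0 lv; exact: aper_rep_transitive ax lw w0 lv.
- exact: delta_ell1Z.
Qed.
End Main.

Theorem theorem4p11 (R : realType) (X : topologicalType)
    (sigma : homeomorphism X)
    (X_nonempty : [set: X] !=set0)
    (X_compact : compact [set: X])
    (X_hausdorff : hausdorff_space X) :
  (@ell1 R X `&`
     \bigcap_(i in orbit_closures sigma (Per sigma) `*` @circle R)
       @P_per R X sigma i.1 i.2)
    `&`
  (@ell1 R X `&`
     \bigcap_(O in orbit_closures sigma (Aper sigma)) @P_aper R X sigma O)
    = [set 0]
  /\ semisimple (@ell1 R X) (@ell1_mul R X sigma).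
Proof.
split; last exact: ell1_semisimple.
apply/seteqP; split=> [a [[ea per] [_ aper]]|_ ->].
  apply: (@ell1_eq0 _ _ sigma) => // [x p om hp om1|x n ax].
    have [_ px _] := hp; apply: (P_per_fourier X_nonempty X_compact X_hausdorff hp om1).
    (* Every [om] on the circle is reached by the parameter [lambda = om ^+ p.+1], so one orbit
       supplies all the Fourier conditions. *)
    apply: (per (closure (Defs.orbit sigma x), om ^+ p.+1)); split=> /=.
      by exists x => //; exact: iter_fix_Per px.
    by rewrite /circle/= normrX om1 expr1n.
  by apply: P_aper_eq0 => //; apply: aper; exists x.
have e0 : ell1 (0 : int -> X -> R[i]) by exact: ell1_0.
split; (split; first exact: e0).
  move=> [_ lam] [/= [x px <-] l1]; have [p hp] := Per_has_period px.
  exists x, p; split=> //; split=> // v.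
  by rewrite per_rep_mulmx// aper_rep0; apply/colP => i; rewrite !mxE.
move=> _ [x ax <-]; split; first exact: e0.
by exists x; split=> // v _; exact: aper_rep0.
Qed.
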